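(* Let $\mathcal{S}=\{n^2-1: n\in\mathbb{N},\ n>1\}$. Then for Lebesgue-almost all real numbers $x$, $$\lim_{n\to\infty}\frac1n\#\{1\le i\le n: a_i(x)\in\mathcal{S}\}=\log_2\frac{8\pi}{e^{\pi}-e^{-\pi}}.$$
   Context: Every irrational real number $x$ has a unique infinite continued fraction expansion $x=a_0+\cfrac{1}{a_1+\cfrac{1}{a_2+\cdots}}=[a_0;a_1,a_2,\dots]$ with $a_0=\lfloor x\rfloor\in\mathbb{Z}$ and $a_i=a_i(x)$ positive integers for $i\ge1$; the $a_i(x)$, $i\ge 1$, are called the continued fraction digits of $x$. $\mathbb{N}=\{1,2,3,\dots\}$ and $\log_2$ denotes the base-2 logarithm. *)

(* Defs.v *)
From HB Require Import structures.
From mathcomp Require Import all_boot all_order all_algebra.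
From mathcomp Require Import all_classical all_reals all_analysis.

Set Implicit Arguments.
Unset Strict Implicit.
Unset Printing Implicit Defensive.

Import Order.TTheory GRing.Theory Num.Theory numFieldNormedType.Exports.
Local Open Scope classical_set_scope.
Local Open Scope ring_scope.

(* The finite continued fraction [a 0; a 1, ..., a n]. *)
Fixpoint cf_convergent {R : realType} (a : nat -> int) (n : nat) : R :=
  if n is m.+1 then (a 0)%:~R + (cf_convergent (fun k => a k.+1) m)^-1
  else (a 0)%:~R.

Definition is_cf_expansion {R : realType} (x : R) (a : nat -> int) : Prop :=
  [/\ a 0 = Num.floor x,
      forall i, (1 <= i)%N -> 0 < a i
    & cf_convergent a n @[n --> \oo] --> x].

(* An irrational x has exactly one expansion and [cf_digits x] is it.  A
   rational x has no infinite expansion; its digits then take the dummy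
   value 0. *)
Definition cf_digits {R : realType} (x : R) : nat -> int :=
  xget (fun=> 0) [set a | is_cf_expansion x a].

Definition square_minus_one : set int :=
  [set n%:Z ^+ 2 - 1 | n in [set n : nat | (1 < n)%N]].

Definition cf_digit_count {R : realType} (S : set int) (x : R) (n : nat) : nat :=
  count (fun i => cf_digits x i \in S) (iota 1 n).

Definition log2 {R : realType} (y : R) : R := ln y / ln 2.

(* Main.v *)
(* Write [x = (p z + p') / (z + s)] with [z] the current tail of the continued
   fraction, [p] the last convergent and [s] the ratio of the last two
   denominators.  Under Lebesgue measure on the
   cylinder the next digit is [k] with probability
   [(1 + s) / ((k + s) (k + 1 + s))], and [s] becomes [1 / (k + s)]: the pair is
   a Markov chain.  Its transition operator [transfer] reverses monotonicity on
   [0, 1] and halves the oscillation of monotone functions, and it preserves the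
   integral against [ds / (1 + s)].  The probability that the next digit is of
   the form [n ^ 2 - 1] is an increasing function of [s], because all such digits
   are at least 3; hence its iterates converge uniformly, at a geometric rate,
   to the constant [c] that is the asserted frequency.  Summing the iterates
   solves the Poisson equation approximately, which gives a Lyapunov function
   and, by a Chernoff bound, exponentially small measure for the set of [x] whose
   digit count deviates from [n c] by [n e]; Borel-Cantelli concludes.  The value
   of [c] comes from the product of the [1 + 1 / n ^ 2], computed with the
   integrals of [cosh (2 t) cos t ^ n] over [0, pi / 2]. *)

Require Import Defs.
From HB Require Import structures.
From mathcomp Require Import all_boot all_order all_algebra.
From mathcomp Require Import all_classical all_reals all_analysis.
From mathcomp Require Import zify ring lra.

Set Implicit Arguments.
Unset Strict Implicit.
Unset Printing Implicit Defensive.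

Import Order.TTheory GRing.Theory Num.Theory numFieldNormedType.Exports.
Local Open Scope classical_set_scope.
Local Open Scope ring_scope.

(** * Continued fraction digits *)

Lemma cvg_dist_le {R : realType} (u e : nat -> R) (l : R) :
  (forall n, `|l - u n| <= e n) -> e n @[n --> \oo] --> (0 : R) ->
  u n @[n --> \oo] --> l.
Proof.
move=> ue e0; apply/subr_cvg0; apply: norm_cvg0.
apply: (squeeze_cvgr _ (cvg_cst 0) e0).
by apply: nearW => n; rewrite normr_ge0/= distrC ue.
Qed.

Section digits.
Context {R : realType}.
Implicit Types (x z : R) (a : nat -> int).

(** Acts on complete quotients: the result is the whole tail [[a 1; a 2, ...]], which exceeds 1, and
    not its fractional part as for the usual Gauss map. *)
Definition gauss x : R := (x - (Num.floor x)%:~R)^-1.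

Lemma irrational_neq_int x (m : int) : irrational x -> x != m%:~R.
Proof. by move=> ix; apply/eqP => xm; apply: ix; exists m%:~R; rewrite // xm ratr_int. Qed.

Lemma irrational_frac_gt0 x : irrational x -> 0 < x - (Num.floor x)%:~R.
Proof.
by move=> ix; rewrite subr_gt0 lt_neqAle floor_le andbT eq_sym irrational_neq_int.
Qed.

Lemma gauss_gt1 x : irrational x -> 1 < gauss x.
Proof.
move=> /irrational_frac_gt0 x0; rewrite invf_gt1//.
by have := floorD1_gt x; rewrite intrD; lra.
Qed.

Lemma gauss_irrational x : irrational x -> irrational (gauss x).
Proof.
move=> ix [q _ qx]; apply: ix; exists ((Num.floor x)%:~R + q^-1) => //.
by rewrite rmorphD/= fmorphV/= qx invrK ratr_int addrC subrK.
Qed.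

Lemma iter_gauss_irrational x n : irrational x -> irrational (iter n gauss x).
Proof. by move=> ix; elim: n => //= n; exact: gauss_irrational. Qed.

Lemma gaussE x : x = (Num.floor x)%:~R + (gauss x)^-1.
Proof. by rewrite invrK addrC subrK. Qed.

Lemma floor_irrational_gt0 z : 1 < z -> 0 < Num.floor z.
Proof. by move=> z1; rewrite floor_gt0 ltW. Qed.

Lemma cf_convergent_itv a n : (forall i, 0 < a i) ->
  (a 0)%:~R <= (cf_convergent a n : R) <= (a 0)%:~R + 1.
Proof.
elim: n a => [a _|n IH a a0] /=; first by rewrite lexx lerDl ler01.
have /andP[+ _] := IH (fun k => a k.+1) (fun k => a0 k.+1).
move: (a0 1); rewrite gtz0_ge1 -(ler_int R) => a1 /(le_trans a1) c1.
rewrite lerDl lerD2l invr_ge0 invf_le1 ?c1 ?andbT; first exact: le_trans c1.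
exact: lt_le_trans c1.
Qed.

Lemma cf_convergent_ge1 a n : (forall i, 0 < a i) -> 1 <= (cf_convergent a n : R).
Proof.
move=> a0; have /andP[+ _] := @cf_convergent_itv a n a0; apply: le_trans.
by move: (a0 0); rewrite gtz0_ge1 -(ler_int R).
Qed.

(** The convergents of [a] are [a 0] plus the inverses of those of the tail, so the latter converge
    to [gauss x]. They lie in [[a 1, a 1 + 1]], and irrationality excludes the right end point, so
    the floor of the limit is [a 1]. *)
Lemma is_cf_expansion_tail x a : irrational x -> is_cf_expansion x a ->
  is_cf_expansion (gauss x) (fun k => a k.+1).
Proof.
move=> ix [a0 apos cvx].
have ap i : 0 < a i.+1 by exact: apos.
have cvT : cf_convergent (fun k => a k.+1) n @[n --> \oo] --> gauss x.
  under eq_fun do rewrite -[cf_convergent _ _]invrK.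
  apply: cvgV; first by rewrite gt_eqF// irrational_frac_gt0.
  have -> : (fun n => (cf_convergent (fun k => a k.+1) n)^-1) =
     (fun n => cf_convergent a n.+1 - (Num.floor x)%:~R :> R).
    by apply/funext => n /=; rewrite a0 addrAC subrr add0r.
  by apply: cvgB; [move: cvx; rewrite -(cvg_shiftS (cf_convergent a))|exact: cvg_cst].
split=> //.
apply/esym/eqP; rewrite floor_eq; apply/andP; split.
  have <- := cvg_lim (@Rhausdorff R) cvT.
  apply: limr_ge; first by apply/cvg_ex; exists (gauss x).
  by apply: nearW => n; case/andP: (@cf_convergent_itv (fun k => a k.+1) n ap).
rewrite lt_neqAle irrational_neq_int /=; last exact: gauss_irrational.
have <- := cvg_lim (@Rhausdorff R) cvT.
apply: limr_le; first by apply/cvg_ex; exists (gauss x).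
apply: nearW => n; rewrite intrD.
by case/andP: (@cf_convergent_itv (fun k => a k.+1) n ap).
Qed.

Lemma is_cf_expansion_floor x a i : irrational x -> is_cf_expansion x a ->
  a i = Num.floor (iter i gauss x).
Proof.
elim: i x a => [x a _ []//|i IH x a ix xa].
rewrite iterSr; apply: (IH _ (fun k => a k.+1)); first exact: gauss_irrational.
exact: is_cf_expansion_tail.
Qed.

Definition gauss_digits x i : int := Num.floor (iter i gauss x).

Lemma gauss_digitsS x : (fun k => gauss_digits x k.+1) = gauss_digits (gauss x).
Proof. by apply/funext => k; rewrite /gauss_digits iterSr. Qed.

Lemma gauss_digits_gt0 x i : irrational x -> 1 < x -> 0 < gauss_digits x i.
Proof.
move=> ix x1; apply: floor_irrational_gt0.
by case: i => //= i; apply/gauss_gt1/iter_gauss_irrational.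
Qed.

(* Two consecutive tails [y = b + 1/z] satisfy [y z >= 2], and so do the
   corresponding convergents: the error is divided by 4 every second step. *)
Lemma cf_convergent_dist z n : irrational z -> 1 < z ->
  `|z - cf_convergent (gauss_digits z) n| <= 2 / 2 ^+ n.
Proof.
have dist (x y c : R) : x = (Num.floor x)%:~R + y^-1 -> 1 <= y -> 1 <= c ->
  `|x - ((Num.floor x)%:~R + c^-1)| = `|y - c| / (y * c) :> R.
  move=> xE y1 c1; rewrite {1}xE.
  have y0 : 0 < y by exact: lt_le_trans y1.
  have c0 : 0 < c by exact: lt_le_trans c1.
  rewrite -[X in _ / X]gtr0_norm ?mulr_gt0// -normf_div -normrN.
  by congr `| _ |; field; rewrite !gt_eqF.
have pair (b c : R) : 1 <= b -> 1 <= c -> 2 <= (b + c^-1) * c.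
  move=> b1 c1; rewrite mulrDl mulVf ?gt_eqF//; first by nra.
  exact: lt_le_trans c1.
elim/ltn_ind: n z => -[|[|n]] IH z iz z1 /=.
- rewrite expr0 divr1 ger0_norm ?subr_ge0 ?floor_le//.
  by have := floorD1_gt z; rewrite intrD /gauss_digits/=; lra.
- have y1 := gauss_gt1 iz.
  have d1 : 1 <= ((gauss_digits z 1)%:~R : R).
    by have := gauss_digits_gt0 1 iz z1; rewrite gtz0_ge1 -(ler_int R).
  rewrite expr1 divff// (dist _ _ _ (gaussE z) (ltW y1) d1).
  rewrite ler_pdivrMr; last by nra.
  rewrite ger0_norm ?subr_ge0 ?floor_le// mul1r.
  by have := floorD1_gt (gauss z); rewrite intrD /gauss_digits/=; nra.
have iy := gauss_irrational iz; have y1 := gauss_gt1 iz.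
have iw := gauss_irrational iy; have w1 := gauss_gt1 iy.
rewrite (_ : (fun k => gauss_digits z k.+2) = gauss_digits (gauss (gauss z))); last first.
  by rewrite -!gauss_digitsS.
have c1 := cf_convergent_ge1 n (fun i => gauss_digits_gt0 i iw w1).
set c := cf_convergent _ _ in c1 *.
have b1 : 1 <= ((gauss_digits (gauss z) 0)%:~R : R).
  by have := gauss_digits_gt0 0 iy y1; rewrite gtz0_ge1 -(ler_int R).
have D1 : 1 <= (gauss_digits (gauss z) 0)%:~R + c^-1.
  by rewrite (le_trans b1)// lerDl invr_ge0 (le_trans _ c1).
rewrite (dist _ _ _ (gaussE z) (ltW y1) D1).
rewrite (dist _ _ _ (gaussE (gauss z)) (ltW w1) c1).
have := IH n _ (gauss (gauss z)) iw w1; rewrite -/c => /(_ (leqW (leqnn _))) e.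
have yw : 2 <= gauss z * gauss (gauss z).
  by rewrite [X in X * _]gaussE; apply: pair => //; exact: ltW.
have Dc := pair _ _ b1 c1.
rewrite -mulrA -invfM ler_pdivrMr; last by nra.
set D := _ + _ in Dc D1 *.
have n0 : (0 : R) < 2 ^+ n by rewrite exprn_gt0.
have -> : 2 / 2 ^+ n.+2 * (gauss (gauss z) * c * (gauss z * D)) =
  2^-1 * ((gauss z * gauss (gauss z)) * (D * c)) / 2 ^+ n.
  by rewrite !exprS; field; rewrite gt_eqF.
apply: (le_trans e).
rewrite ler_pM2r ?invr_gt0 ?exprn_gt0//; nra.
Qed.

Lemma cvg_half_expn (C : R) : C / 2 ^+ n @[n --> \oo] --> (0 : R).
Proof.
rewrite -(mulr0 C); apply: cvgM; first exact: cvg_cst.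
under eq_fun do rewrite -exprVn.
by apply: cvg_expr; rewrite ger0_norm ?invr_ge0// invf_lt1// ltr1n.
Qed.

Lemma is_cf_expansion_gauss x : irrational x -> is_cf_expansion x (gauss_digits x).
Proof.
move=> ix; split => //.
  case=> // i _; rewrite -[X in 0 < X]/((fun k => gauss_digits x k.+1) i) gauss_digitsS.
  exact: gauss_digits_gt0 (gauss_irrational ix) (gauss_gt1 ix).
(* [x] itself may be below 1, so [cf_convergent_dist] is applied to its tail. *)
suff: (gauss_digits x 0)%:~R + (cf_convergent (gauss_digits (gauss x)) n)^-1 @[n --> \oo]
    --> (Num.floor x)%:~R + (gauss x)^-1.
  by rewrite -gaussE -(cvg_shiftS (cf_convergent _)) /= gauss_digitsS.
apply: cvgD; first exact: cvg_cst.
apply: cvgV; first by rewrite gt_eqF// (lt_trans ltr01)// gauss_gt1.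
apply: cvg_dist_le (cvg_half_expn 2) => n.
by apply: cf_convergent_dist; [exact: gauss_irrational|exact: gauss_gt1].
Qed.

Lemma cf_digitsE x i : irrational x -> cf_digits x i = Num.floor (iter i gauss x).
Proof.
move=> ix; apply: is_cf_expansion_floor => //; rewrite /cf_digits.
apply: (@xgetPex _ (fun=> 0) [set a | is_cf_expansion x a]).
by exists (gauss_digits x); exact: is_cf_expansion_gauss.
Qed.

End digits.

(** * The transition operator on digits *)

Section transfer.
Context {R : realType}.
Implicit Types (s x B : R) (v w : nat -> R) (f : R -> R).

(** Probability, in the state [s], that the next digit exceeds [k]. *)
Definition digit_tail s k : R := (1 + s) / (k%:R + 1 + s).

(** The index [k] stands for the digit [k + 1], here and below. *)
Definition digit_prob s k : R := (1 + s) / ((k%:R + 1 + s) * (k%:R + 2 + s)).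

Definition digit_psum s v n : R := \sum_(k < n) digit_prob s k * v k.

Definition digit_mean s v : R := lim (digit_psum s v n @[n --> \oo]).

Definition transfer f s : R := digit_mean s (fun k => f (k%:R + 1 + s)^-1).

Definition bounded_by B v := forall k, `|v k| <= B.

Lemma denom_gt0 s k : - 1 < s -> 0 < k%:R + 1 + s.
Proof. by move=> s1; have := ler0n R k; lra. Qed.

Lemma digit_tail0 s : - 1 < s -> digit_tail s 0 = 1.
Proof. by move=> s1; rewrite /digit_tail add0r divff// gt_eqF//; lra. Qed.

Lemma digit_tail_ge0 s k : - 1 < s -> 0 <= digit_tail s k.
Proof. by move=> s1; rewrite divr_ge0 ?(ltW (denom_gt0 _ s1))//; lra. Qed.

Lemma digit_probE s k : - 1 < s ->
  digit_prob s k = digit_tail s k - digit_tail s k.+1.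
Proof.
move=> s1; have k0 := denom_gt0 k s1; have k1 := denom_gt0 k.+1 s1.
rewrite /digit_prob /digit_tail; move: k1; rewrite -natr1 => k1.
by field; apply/andP; split; rewrite gt_eqF//; lra.
Qed.

Lemma digit_prob_gt0 s k : - 1 < s -> 0 < digit_prob s k.
Proof.
move=> s1; have k0 := denom_gt0 k s1.
by rewrite divr_gt0 ?mulr_gt0//; lra.
Qed.

Lemma sum_digit_prob s n : - 1 < s ->
  \sum_(k < n) digit_prob s k = 1 - digit_tail s n.
Proof.
move=> s1; elim: n => [|n IH]; first by rewrite big_ord0 digit_tail0 ?subrr.
by rewrite big_ord_recr/= IH digit_probE//; ring.
Qed.

Lemma digit_tail_le s n : - 1 < s -> digit_tail s n.+1 <= (1 + s) / n.+1%:R.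
Proof.
move=> s1; rewrite ler_wpM2l//; first by lra.
rewrite lef_pV2 ?posrE// ?ltr0n//; first by lra.
exact: denom_gt0.
Qed.

Lemma cvg_harmonic_mul (C : R) : C / n.+1%:R @[n --> \oo] --> (0 : R).
Proof. by rewrite -(mulr0 C); apply: cvgM; [exact: cvg_cst|exact: cvg_harmonic]. Qed.

Lemma cvg_digit_tail s : - 1 < s -> digit_tail s n @[n --> \oo] --> (0 : R).
Proof.
move=> s1; rewrite -cvg_shiftS; apply: cvg_dist_le (cvg_harmonic_mul (1 + s)) => n.
by rewrite sub0r normrN ger0_norm ?digit_tail_ge0// digit_tail_le.
Qed.

Lemma digit_psum_bound s B v m n : - 1 < s -> bounded_by B v -> (m <= n)%N ->
  `|digit_psum s v n - digit_psum s v m| <= B * digit_tail s m.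
Proof.
move=> s1 vB mn.
have B0 : 0 <= B by exact: le_trans (vB 0).
suff : `|digit_psum s v n - digit_psum s v m| <=
    B * (digit_tail s m - digit_tail s n).
  by move/le_trans; apply; rewrite ler_wpM2l// gerBl digit_tail_ge0.
rewrite -(subnKC mn); elim: (n - m)%N => [|k IH].
  by rewrite addn0 !subrr mulr0 normr0.
rewrite addnS {1}/digit_psum big_ord_recr/= -/(digit_psum s v (m + k)) addrAC.
rewrite (le_trans (ler_normD _ _))//.
have -> : B * (digit_tail s m - digit_tail s (m + k).+1) =
  B * (digit_tail s m - digit_tail s (m + k)) + digit_prob s (m + k) * B.
  by rewrite digit_probE//; ring.
by rewrite lerD// normrM gtr0_norm ?digit_prob_gt0// ler_wpM2l// ltW// digit_prob_gt0.
Qed.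

Lemma cvg_digit_mean s B v : - 1 < s -> bounded_by B v ->
  digit_psum s v n @[n --> \oo] --> digit_mean s v.
Proof.
move=> s1 vB.
have B0 : 0 <= B by exact: le_trans (vB 0).
suff : cvgn (series (fun k => digit_prob s k * v k)) by rewrite seriesEord.
apply: normed_cvg.
apply: (@series_le_cvg _ _ (fun k => B * digit_prob s k)).
- by move=> n /=.
- by move=> n; rewrite mulr_ge0// ltW// digit_prob_gt0.
- move=> n /=; rewrite normrM gtr0_norm ?digit_prob_gt0// mulrC.
  by rewrite ler_wpM2r// ltW// digit_prob_gt0.
rewrite seriesEord; apply/cvg_ex; exists (B * (1 - 0)).
under eq_fun do rewrite -mulr_sumr sum_digit_prob//.
apply: cvgM; first exact: cvg_cst.
by apply: cvgB; [exact: cvg_cst|exact: cvg_digit_tail].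
Qed.

Lemma digit_mean_dist s B v n : - 1 < s -> bounded_by B v ->
  `|digit_mean s v - digit_psum s v n| <= B * digit_tail s n.
Proof.
move=> s1 vB; have cv := cvg_digit_mean s1 vB.
have cvn : `|digit_psum s v m - digit_psum s v n| @[m --> \oo] -->
    `|digit_mean s v - digit_psum s v n|.
  by apply: cvg_norm; apply: cvgB => //; exact: cvg_cst.
rewrite -(cvg_lim (@Rhausdorff R) cvn); apply: limr_le.
  by apply/cvg_ex; eexists; exact: cvn.
by exists n => // m /= nm; exact: digit_psum_bound.
Qed.

Lemma digit_mean_unique s B v l : - 1 < s -> bounded_by B v ->
  digit_psum s v n @[n --> \oo] --> l -> digit_mean s v = l.
Proof. by move=> s1 vB vl; exact: cvg_lim. Qed.

Lemma digit_mean_le s B v w : - 1 < s -> bounded_by B v -> bounded_by B w ->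
  (forall k, v k <= w k) -> digit_mean s v <= digit_mean s w.
Proof.
move=> s1 vB wB vw; apply: ler_lim.
- by apply/cvg_ex; exists (digit_mean s v); exact: cvg_digit_mean vB.
- by apply/cvg_ex; exists (digit_mean s w); exact: cvg_digit_mean wB.
- by apply: nearW => n; apply: ler_sum => k _; rewrite ler_wpM2l// ltW// digit_prob_gt0.
Qed.

Lemma digit_mean_cst s c : - 1 < s -> digit_mean s (fun=> c) = c.
Proof.
move=> s1; apply: (@digit_mean_unique s `|c|) => //.
rewrite -[X in _ --> X]subr0 -[X in X - 0]mul1r -(mul0r c) -mulrBl.
rewrite /digit_psum; under eq_fun do rewrite -mulr_suml sum_digit_prob//.
apply: cvgM; last exact: cvg_cst.
by apply: cvgB; [exact: cvg_cst|exact: cvg_digit_tail].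
Qed.

Lemma digit_meanZD s B c v w : - 1 < s -> bounded_by B v -> bounded_by B w ->
  digit_mean s (fun k => c * v k + w k) = c * digit_mean s v + digit_mean s w.
Proof.
move=> s1 vB wB; apply: (@digit_mean_unique s (`|c| * B + B)) => //.
  move=> k; rewrite (le_trans (ler_normD _ _))// lerD// normrM ler_wpM2l//.
rewrite /digit_psum; under eq_fun.
  by move=> n; under eq_bigr do rewrite mulrDr mulrCA; rewrite big_split/= -mulr_sumr; over.
apply: cvgD; last exact: cvg_digit_mean wB.
by apply: cvgM; [exact: cvg_cst|exact: cvg_digit_mean vB].
Qed.

Lemma digit_mean_itv s B v a b : - 1 < s -> bounded_by B v ->
  (forall k, a <= v k <= b) -> a <= digit_mean s v <= b.
Proof.
move=> s1 vB vab.
have vB' : bounded_by (B + `|a| + `|b|) v.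
  by move=> k; have := vB k; have := normr_ge0 a; have := normr_ge0 b; lra.
have B0 : 0 <= B by exact: le_trans (vB 0).
have cB c : `|c| <= `|a| + `|b| -> bounded_by (B + `|a| + `|b|) (fun=> c).
  by move=> cab k; lra.
have na := normr_ge0 a; have nb := normr_ge0 b.
have aB : bounded_by (B + `|a| + `|b|) (fun=> a) by apply: cB; lra.
have bB : bounded_by (B + `|a| + `|b|) (fun=> b) by apply: cB; lra.
have := digit_mean_le s1 aB vB' (fun k => proj1 (andP (vab k))).
have := digit_mean_le s1 vB' bB (fun k => proj2 (andP (vab k))).
by rewrite !digit_mean_cst// => -> ->.
Qed.

(** Summation by parts writes the mean as [v 0] plus the increments of [v], all nonpositive,
    weighted by [digit_tail s k.+1], which increases with [s]. *)
Lemma digit_mean_anti s s' B v : - 1 < s -> s <= s' -> bounded_by B v ->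
  (forall k, v k.+1 <= v k) -> digit_mean s' v <= digit_mean s v.
Proof.
move=> s1 ss' vB vd.
have s'1 : - 1 < s' by exact: lt_le_trans ss'.
have abel x n : - 1 < x -> digit_psum x v n + digit_tail x n * v n =
    v 0 + \sum_(k < n) digit_tail x k.+1 * (v k.+1 - v k).
  move=> x1; elim: n => [|n IH].
    by rewrite /digit_psum !big_ord0 digit_tail0//; ring.
  rewrite /digit_psum !big_ord_recr/= -/(digit_psum x v n) addrA -IH.
  by rewrite digit_probE//; ring.
have cvb x : - 1 < x ->
    v 0 + \sum_(k < n) digit_tail x k.+1 * (v k.+1 - v k) @[n --> \oo] --> digit_mean x v.
  move=> x1; under eq_fun do rewrite -abel//.
  rewrite -(addr0 (digit_mean x v)); apply: cvgD; first exact: cvg_digit_mean vB.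
  apply: cvg_dist_le; last first.
    rewrite -(mul0r B); apply: cvgM; first exact: cvg_digit_tail x1.
    exact: cvg_cst.
  move=> n; rewrite sub0r normrN normrM ger0_norm ?digit_tail_ge0//.
  by rewrite ler_wpM2l// digit_tail_ge0.
rewrite -(cvg_lim (@Rhausdorff R) (cvb _ s1)) -(cvg_lim (@Rhausdorff R) (cvb _ s'1)).
apply: ler_lim; [by apply/cvg_ex; eexists; exact: cvb..|].
apply: nearW => n; rewrite lerD2l ler_sum// => k _.
rewrite ler_wnM2r ?subr_le0//.
have k0 := denom_gt0 k.+1 s1; have k1 := denom_gt0 k.+1 s'1.
rewrite /digit_tail ler_pdivrMr// mulrAC ler_pdivlMr//.
by have := ler0n R k.+1; nra.
Qed.

End transfer.

(** * Continuity, monotonicity and oscillation under [transfer] *)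

Section transfer_regularity.
Context {R : realType}.
Implicit Types (s x y B : R) (f : R -> R).

(* The domain is larger than [0, 1] to make continuity at 0 two-sided. *)
Definition dom_bounded B f := forall s, - 2^-1 < s -> `|f s| <= B.

Definition dom_continuous f := forall s, - 2^-1 < s -> {for s, continuous f}.

Lemma branch_gt0 s k : - 1 < s -> 0 < (k%:R + 1 + s)^-1.
Proof. by move=> s1; rewrite invr_gt0 denom_gt0. Qed.

Lemma branch_dom s k : - 1 < s -> - 2^-1 < (k%:R + 1 + s)^-1.
Proof. by move=> s1; have := branch_gt0 k s1; lra. Qed.

Lemma branch_le1 s k : 0 <= s -> (k%:R + 1 + s)^-1 <= 1.
Proof.
by move=> s0; rewrite invf_le1 ?denom_gt0//; have := ler0n R k; lra.
Qed.

Lemma dom_bounded_branch B f s : dom_bounded B f -> - 1 < s ->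
  bounded_by B (fun k => f (k%:R + 1 + s)^-1).
Proof. by move=> fB s1 k; apply: fB; exact: branch_dom. Qed.

Lemma digit_mean_bounded B (v : nat -> R -> R) :
  (forall k, dom_bounded B (v k)) -> dom_bounded B (fun s => digit_mean s (v^~ s)).
Proof.
move=> vB s s1; have s1' : - 1 < s by lra.
rewrite ler_norml; apply: (@digit_mean_itv _ _ B) => // k; first exact: vB.
by rewrite -ler_norml; exact: vB.
Qed.

Lemma dom_continuousM f g : dom_continuous f -> dom_continuous g ->
  dom_continuous (fun s => f s * g s).
Proof. by move=> cf cg s s1; apply: cvgM; [exact: cf|exact: cg]. Qed.

Lemma branch_dom_continuous k : dom_continuous (fun s => (k%:R + 1 + s)^-1).
Proof.
move=> s s1; apply: cvgV; first by rewrite gt_eqF// denom_gt0//; lra.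
by apply: cvgD; [exact: cvg_cst|exact: cvg_id].
Qed.

Lemma digit_prob_dom_continuous k : dom_continuous (fun s => digit_prob s k).
Proof.
apply: dom_continuousM => s s1.
  by apply: cvgD; [exact: cvg_cst|exact: cvg_id].
have k0 := ler0n R k.
apply: cvgV; first by rewrite gt_eqF// mulr_gt0//; lra.
by apply: cvgM; apply: cvgD; [exact: cvg_cst|exact: cvg_id|exact: cvg_cst|exact: cvg_id].
Qed.

(** For [t < s + 1] the remainder after [N.+1] terms is at most [B * (2 + s) / N.+1%:R], uniformly
    in [t], and the partial sums are continuous. *)
Lemma digit_mean_continuous B (v : nat -> R -> R) :
  (forall k, dom_bounded B (v k)) -> (forall k, dom_continuous (v k)) ->
  dom_continuous (fun s => digit_mean s (v^~ s)).
Proof.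
move=> vB cv s s1; have s1' : - 1 < s by lra.
have B0 : 0 <= B by apply: le_trans (vB 0%N _ s1).
apply/cvgrPdist_le => /= e e0.
have [N _ /(_ N (leqnn _)) NE] : \forall n \near \oo, B * (2 + s) / n.+1%:R <= e / 3.
  have /cvgrPdist_le/(_ (e / 3)) := cvg_harmonic_mul (B * (2 + s)).
  move=> /(_ _)[|N _ NE]; first by rewrite divr_gt0.
  exists N => // n /NE /=; rewrite sub0r normrN ger0_norm// mulr_ge0//.
  by rewrite mulr_ge0//; lra.
have tail t : - 2^-1 < t -> t < s + 1 ->
    `|digit_mean t (v^~ t) - digit_psum t (v^~ t) N.+1| <= e / 3.
  move=> t1 ts; have t1' : - 1 < t by lra.
  rewrite (le_trans (digit_mean_dist (B := B) _ t1' _))//; first by move=> k; exact: vB.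
  apply: le_trans NE; rewrite -mulrA ler_wpM2l// (le_trans (digit_tail_le _ t1'))//.
  by rewrite ler_wpM2r//; lra.
have cps : {for s, continuous (fun t => digit_psum t (v^~ t) N.+1)}.
  apply: cvg_big => [|k _]; first exact: add_continuous.
  by apply: cvgM; [exact: digit_prob_dom_continuous|exact: cv].
move/cvgrPdist_le : cps => /(_ (e / 3)) /(_ _)/=; rewrite divr_gt0// => /(_ isT) cps.
near=> t.
have ht : - 2^-1 < t by near: t; exact: lt_nbhsr.
have ts : t < s + 1 by near: t; apply: lt_nbhsl; rewrite ltrDl.
have d1 := tail t ht ts; have d2 := tail s s1 (ltac:(by rewrite ltrDl)).
have d3 : `|digit_psum s (v^~ s) N.+1 - digit_psum t (v^~ t) N.+1| <= e / 3.
  by near: t.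
move: d1 d2 d3; rewrite !ler_norml => /andP[? ?] /andP[? ?] /andP[? ?].
by apply/andP; split; lra.
Unshelve. all: by end_near. Qed.

Lemma transfer_bounded B f : dom_bounded B f -> dom_bounded B (transfer f).
Proof.
move=> fB; apply: digit_mean_bounded => k s s1.
by apply: fB; apply: branch_dom; lra.
Qed.

Lemma transfer_continuous B f : dom_bounded B f -> dom_continuous f ->
  dom_continuous (transfer f).
Proof.
move=> fB cf; apply: (@digit_mean_continuous B) => k s s1.
  by apply: fB; apply: branch_dom; lra.
apply: continuous_comp; first exact: branch_dom_continuous.
by apply: cf; apply: branch_dom; lra.
Qed.

Definition nondecreasing01 f := forall x y, 0 <= x -> x <= y -> y <= 1 -> f x <= f y.

Definition monotone01 f := nondecreasing01 f \/ nondecreasing01 (\- f).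

Lemma transferN B f s : dom_bounded B f -> - 1 < s ->
  transfer (\- f) s = - transfer f s.
Proof.
move=> fB s1; have vB := dom_bounded_branch fB s1.
have B0 : 0 <= B by exact: le_trans (vB 0%N).
have zB : bounded_by B (fun=> 0 : R) by move=> k; rewrite normr0.
have := digit_meanZD (-1) s1 vB zB; rewrite digit_mean_cst// addr0 mulN1r => <-.
by congr digit_mean; apply/funext => k /=; rewrite mulN1r addr0.
Qed.

(** Raising [s] lowers every branch value [f (k%:R + 1 + s)^-1] and shifts weight to larger digits,
    whose values are smaller. The mean with the weights of [y] and the branches of [x] separates the
    two effects. *)
Lemma transfer_anti B f x y : dom_bounded B f -> nondecreasing01 f ->
  0 <= x -> x <= y -> transfer f y <= transfer f x.
Proof.
move=> fB fnd x0 xy; have x1 : - 1 < x by lra.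
have y1 : - 1 < y by lra.
have xB := dom_bounded_branch fB x1; have yB := dom_bounded_branch fB y1.
have y0 : 0 <= y by lra.
apply: (@le_trans _ _ (digit_mean y (fun k => f (k%:R + 1 + x)^-1))).
  apply: (digit_mean_le y1 yB xB) => k; apply: fnd; last exact: branch_le1.
    by rewrite ltW// branch_gt0.
  by rewrite lef_pV2 ?posrE ?denom_gt0//; lra.
apply: (digit_mean_anti x1 xy xB) => k; apply: fnd; last exact: branch_le1.
  by rewrite ltW// branch_gt0.
by rewrite lef_pV2 ?posrE ?denom_gt0// -natr1; lra.
Qed.

(** From the state 0 the digit 1 has probability 1/2 and leads to the state 1; the branch of index
    [k.+1] at 0 is that of index [k] at 1, with half its weight. *)
Lemma transfer_at0 B f : dom_bounded B f ->
  transfer f 0 = (f 1 + transfer f 1) / 2.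
Proof.
move=> fB; have z1 : - 1 < 0 :> R by lra.
have o1 : - 1 < 1 :> R by lra.
apply: (digit_mean_unique z1 (dom_bounded_branch fB z1)); rewrite -cvg_shiftS.
have -> : (fun n => digit_psum 0 (fun k => f (k%:R + 1 + 0)^-1) n.+1) =
    (fun n => (f 1 + digit_psum 1 (fun k => f (k%:R + 1 + 1)^-1) n) / 2 : R).
  apply/funext => n; rewrite /digit_psum big_ord_recl/= mulrDl mulr_suml.
  congr (_ + _).
    rewrite /digit_prob !(add0r, addr0) invr1 mulrC; congr (_ * _); lra.
  apply: eq_bigr => k _; rewrite /bump/= add1n -natr1 addr0 [RHS]mulrAC; congr (_ * _).
  have k0 := ler0n R k; rewrite /digit_prob -natr1; field.
  by do ?[apply/andP; split]; rewrite gt_eqF//; lra.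
apply: cvgM; last exact: cvg_cst.
apply: cvgD; first exact: cvg_cst.
exact: cvg_digit_mean (dom_bounded_branch fB o1).
Qed.

Lemma dom_boundedN B f : dom_bounded B f -> dom_bounded B (\- f).
Proof. by move=> fB s s1; rewrite /= normrN; exact: fB. Qed.

(* [digit_prob 0 k.+1] is half of [digit_prob 1 k], so the value at 0 is the
   average of [f 1] and of the value at 1, while the latter lies between [f 0]
   and [f 1]. *)
Lemma transfer_osc_nd B f : dom_bounded B f -> nondecreasing01 f ->
  `|transfer f 0 - transfer f 1| <= `|f 0 - f 1| / 2.
Proof.
move=> fB fnd; have o1 : - 1 < 1 :> R by lra.
have /andP[t0 t1] : f 0 <= transfer f 1 <= f 1.
  apply: (digit_mean_itv o1 (dom_bounded_branch fB o1)) => k.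
  have b0 := branch_gt0 k o1; have b1 := branch_le1 k (ler01 : 0 <= 1 :> R).
  by apply/andP; split; apply: fnd => //; exact: ltW.
rewrite (transfer_at0 fB) ger0_norm; last by lra.
by rewrite ler0_norm; lra.
Qed.

Lemma transfer_monotone B f : dom_bounded B f -> monotone01 f ->
  monotone01 (transfer f) /\ `|transfer f 0 - transfer f 1| <= `|f 0 - f 1| / 2.
Proof.
move=> fB [fnd|fnd]; split.
- by right => x y x0 xy y1 /=; rewrite lerN2; exact: transfer_anti fB _ _ _.
- exact: transfer_osc_nd fB fnd.
- left => x y x0 xy y1.
  have := transfer_anti (dom_boundedN fB) fnd x0 xy.
  by rewrite !(transferN fB) ?lerN2//; lra.
have := transfer_osc_nd (dom_boundedN fB) fnd.
rewrite !(transferN fB) /=; [|lra|lra].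
by rewrite !opprK ![- _ + _]addrC distrC [`|f 1 - f 0|]distrC.
Qed.

(** A monotone function on [0, 1] has its oscillation at the end points, and there each application
    of [transfer] halves it. *)
Lemma iter_transfer_dist B f n x y : dom_bounded B f -> nondecreasing01 f ->
  0 <= x <= 1 -> 0 <= y <= 1 ->
  `|iter n transfer f x - iter n transfer f y| <= `|f 0 - f 1| / 2 ^+ n.
Proof.
move=> fB fnd.
have itB m : dom_bounded B (iter m transfer f).
  by elim: m => //= m; exact: transfer_bounded.
have [mono osc] : monotone01 (iter n transfer f) /\
    `|iter n transfer f 0 - iter n transfer f 1| <= `|f 0 - f 1| / 2 ^+ n.
  elim: n => [|n [mono osc]] /=; first by split; [left|rewrite expr0 divr1].
  have [m1 o1] := transfer_monotone (itB n) mono; split=> //.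
  by rewrite (le_trans o1)// exprSr invfM mulrA ler_wpM2r.
move=> /andP[x0 x1] /andP[y0 y1]; apply: le_trans osc.
set g := iter n transfer f in mono *.
rewrite [leRHS]distrC.
case: mono => m; have := m _ _ (lexx 0) x0 x1; have := m _ _ (lexx 0) y0 y1;
  have := m _ _ x0 x1 (lexx 1); have := m _ _ y0 y1 (lexx 1) => /= h1 h2 h3 h4.
  by rewrite [leRHS]ger0_norm ?ler_norml; lra.
by rewrite [leRHS]ler0_norm ?ler_norml; lra.
Qed.

Lemma iter_transfer_bounded B f n : dom_bounded B f -> dom_bounded B (iter n transfer f).
Proof. by move=> fB; elim: n => //= n; exact: transfer_bounded. Qed.

Lemma iter_transfer_continuous B f n : dom_bounded B f -> dom_continuous f ->
  dom_continuous (iter n transfer f).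
Proof.
move=> fB cf; elim: n => //= n IH; apply: (@transfer_continuous B) => //.
exact: iter_transfer_bounded.
Qed.

End transfer_regularity.

(** * The invariant integral *)

Section derivative_rules.
Context {R : realType}.
Implicit Types (f g : R -> R) (x a b c : R).

(** These variants of the rules accept the derivative in any form [c], leaving an equation to prove,
    and take functions in pointwise form. *)
Lemma derD f g x a b c : is_derive x 1 f a -> is_derive x 1 g b -> c = a + b ->
  is_derive x 1 (fun t => f t + g t) c.
Proof. by move=> df dg ->; exact: is_deriveD. Qed.

Lemma derN f x a c : is_derive x 1 f a -> c = - a -> is_derive x 1 (fun t => - f t) c.
Proof. by move=> df ->; exact: is_deriveN. Qed.

Lemma derB f g x a b c : is_derive x 1 f a -> is_derive x 1 g b -> c = a - b ->
  is_derive x 1 (fun t => f t - g t) c.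
Proof. by move=> df dg ->; exact: is_deriveB. Qed.

Lemma derM f g x a b c : is_derive x 1 f a -> is_derive x 1 g b ->
  c = a * g x + f x * b -> is_derive x 1 (fun t => f t * g t) c.
Proof.
move=> df dg ->; apply: (is_derive_eq (is_deriveM df dg)).
by rewrite /GRing.scale/= addrC [g x * _]mulrC.
Qed.

Lemma derZ k f x a c : is_derive x 1 f a -> c = k * a ->
  is_derive x 1 (fun t => k * f t) c.
Proof. by move=> df ->; exact: is_deriveZ. Qed.

Lemma derV f x a c : f x != 0 -> is_derive x 1 f a -> c = - a / (f x * f x) ->
  is_derive x 1 (fun t => (f t)^-1) c.
Proof.
move=> fx df ->; apply: (is_derive_eq (is_deriveV fx df)).
by rewrite /GRing.scale/= expr2 mulNr mulrC mulNr.
Qed.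

Lemma der_comp f g x a b c : is_derive (g x) 1 f a -> is_derive x 1 g b ->
  c = a * b -> is_derive x 1 (fun t => f (g t)) c.
Proof. by move=> df dg ->; exact: is_derive1_comp. Qed.

Lemma der_addl k x : is_derive x 1 (fun t => k + t) 1.
Proof.
by apply: (derD (is_derive_cst k x 1) (is_derive_id x 1)); rewrite add0r.
Qed.

Lemma der_ln_addl k x : 0 < k + x -> is_derive x 1 (fun t => ln (k + t)) (k + x)^-1.
Proof.
move=> kx; by apply: (der_comp (is_derive1_ln kx) (der_addl k x)); rewrite mulr1.
Qed.

Lemma der_continuous f x a : is_derive x 1 f a -> {for x, continuous f}.
Proof.
by move=> [df _]; apply/differentiable_continuous; rewrite -derivable1_diffP.
Qed.

Lemma mean_value f df a b : a < b ->
  (forall x, a <= x <= b -> is_derive x 1 f (df x)) ->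
  exists2 c, a < c < b & f b - f a = df c * (b - a).
Proof.
move=> ab fd; have [||c cab fE] := @MVT _ f df _ _ ab.
- by move=> x /[!in_itv]/= /andP[ax xb]; apply: fd; rewrite !ltW.
- apply/derivable_within_continuous => x /[!in_itv]/= xab.
  by have [] := fd x xab.
by exists c => //; move: cab; rewrite in_itv.
Qed.

(** The integral starts at [a], strictly below [b], so that the derivative at [b] is two-sided. *)
Lemma primitive_exists f a b : a < b -> (forall x, a <= x -> {for x, continuous f}) ->
  exists F : R -> R, forall x, b <= x -> is_derive x 1 F (f x).
Proof.
move=> ab cf; exists (fun x => \int[lebesgue_measure]_(t in `[a, x]) f t) => x bx.
have ax : a < x by exact: lt_le_trans bx.
have xx1 : x < x + 1 by rewrite ltrDl.
have fi : (@lebesgue_measure R).-integrable `[a, x + 1] (EFin \o f).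
  apply: continuous_compact_integrable; first exact: segment_compact.
  apply/continuous_in_subspaceT => y; rewrite inE/= in_itv/= => /andP[ay _].
  exact: cf.
have [dF <-] := continuous_FTC1_closed xx1 fi ax (cf x (ltW ax)).
by apply: DeriveDef; [exact: dF|rewrite -derive1E].
Qed.

End derivative_rules.

Section gauss_integral.
Context {R : realType}.
Implicit Types (s B : R) (f : R -> R).

(** Termwise integration, with primitives in place of integrals: the remainder of the series,
    divided by [1 + s], is at most [B / n.+1%:R] on [0, 1], and the mean value theorem carries this
    bound over to the primitives. *)
Lemma digit_mean_integral B (v F : nat -> R -> R) (W : R -> R) :
  (forall k, dom_bounded B (v k)) ->
  (forall k s, 0 <= s -> is_derive s 1 (F k) (digit_prob s k * v k s / (1 + s))) ->
  (forall s, 0 <= s -> is_derive s 1 W (digit_mean s (v^~ s) / (1 + s))) ->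
  \sum_(k < n) (F k 1 - F k 0) @[n --> \oo] --> W 1 - W 0.
Proof.
move=> vB dF dW; rewrite -cvg_shiftS.
apply: cvg_dist_le (cvg_harmonic_mul B) => n.
have exch (p q r t : R) : p - q - (r - t) = p - r - (q - t) by ring.
pose G := W - \sum_(k < n.+1) F k.
have dG s : 0 <= s <= 1 ->
    is_derive s 1 G ((digit_mean s (v^~ s) - digit_psum s (v^~ s) n.+1) / (1 + s)).
  move=> /andP[s0 _]; have dS := is_derive_sum (fun k : 'I_n.+1 => dF k s s0).
  apply: (is_derive_eq (is_deriveB (dW s s0) dS)); last first.
    by rewrite mulrBl /digit_psum mulr_suml.
have B0 : 0 <= B by apply: le_trans (vB 0%N 0 _); rewrite // oppr_lt0 invr_gt0.
have [c /andP[c0 c1]] := mean_value ltr01 dG.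
have [cm1 c1p c2] : [/\ - 1 < c, 0 < 1 + c & - 2^-1 < c] by clear -c0; split; lra.
rewrite subr0 mulr1 sumrB => GE.
have -> : W 1 - W 0 - (\sum_(i < n.+1) F i 1 - \sum_(i < n.+1) F i 0) = G 1 - G 0.
  by rewrite /G !fctE !fct_sumE exch.
rewrite GE normrM [X in _ * X]gtr0_norm ?invr_gt0//.
rewrite ler_pdivrMr// (le_trans (digit_mean_dist (B := B) _ cm1 _))//.
  by move=> k; exact: vB.
rewrite -mulrA [_^-1 * _]mulrC ler_wpM2l//; exact: digit_tail_le.
Qed.

(** Substituting [t = (k%:R + 1 + s)^-1] turns the term of index [k] into the integral of
    [f t / (1 + t)] over [[1 / (k + 2), 1 / (k + 1)]]; these intervals tile []0, 1]]. *)
Lemma transfer_integral B f (V W : R -> R) : dom_bounded B f ->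
  (forall s, 0 <= s -> is_derive s 1 V (f s / (1 + s))) ->
  (forall s, 0 <= s -> is_derive s 1 W (transfer f s / (1 + s))) ->
  W 1 - W 0 = V 1 - V 0.
Proof.
move=> fB dV dW.
have vB k : dom_bounded B (fun s => f (k%:R + 1 + s)^-1).
  by move=> s s1; apply: fB; apply: branch_dom; lra.
pose F k s := - V (k%:R + 1 + s)^-1.
have dF k s : 0 <= s ->
    is_derive s 1 (F k) (digit_prob s k * f (k%:R + 1 + s)^-1 / (1 + s)).
  move=> s0; have k0 := ler0n R k; have s1 : - 1 < s by lra.
  have ks0 : k%:R + 1 + s != 0 by rewrite gt_eqF// denom_gt0.
  have dg := derV (f := fun t => k%:R + 1 + t) ks0 (der_addl _ _) erefl.
  have dc := der_comp (g := fun t => (k%:R + 1 + t)^-1) (dV _ (ltW (branch_gt0 k s1))) dg erefl.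
  apply: (derN dc).
  rewrite /digit_prob; field.
  by do ?[apply/andP; split]; rewrite gt_eqF//; lra.
have := digit_mean_integral vB dF dW.
have -> : (fun n => \sum_(k < n) (F k 1 - F k 0)) = (fun n => V 1 - V (n%:R + 1)^-1).
  apply/funext; elim => [|n IH]; first by rewrite big_ord0 add0r invr1 subrr.
  by rewrite big_ord_recr/= IH /F addr0 -natr1; ring.
move=> WE; apply: (@cvg_unique _ (@Rhausdorff R) _ _ _ _ WE).
apply: cvgB; first exact: cvg_cst.
apply: (@cvg_comp _ _ _ (fun n => (n%:R + 1)^-1 : R) V).
  by under eq_fun do rewrite natr1; exact: cvg_harmonic.
exact: der_continuous (dV 0 (lexx 0)).
Qed.

Lemma dom_continuous_primitive f : dom_continuous f ->
  exists V : R -> R, forall s, 0 <= s -> is_derive s 1 V (f s / (1 + s)).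
Proof.
(* The base point lies left of 0 but within [- 2^-1 < s], where [f] is continuous. *)
move=> cf; apply: (@primitive_exists _ _ (- 4^-1)); first by lra.
move=> x x0; apply: cvgM; first by apply: cf; lra.
apply: cvgV; first by rewrite gt_eqF//; lra.
by apply: cvgD; [exact: cvg_cst|exact: cvg_id].
Qed.

(* [f] is integrated against the invariant density [1 / (1 + s)], the integral
   being that of every iterate, which is constant up to [C / 2 ^+ n]. *)
Lemma iter_transfer_cvg B f (V : R -> R) n s : dom_bounded B f -> dom_continuous f ->
  nondecreasing01 f ->
  (forall s, 0 <= s -> is_derive s 1 V (f s / (1 + s))) -> 0 <= s <= 1 ->
  `|iter n transfer f s * ln 2 - (V 1 - V 0)| <= 2 * B / 2 ^+ n.
Proof.
move=> fB cf fnd dV s01.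
have [W dW WE] : exists2 W : R -> R,
    (forall s, 0 <= s -> is_derive s 1 W (iter n transfer f s / (1 + s))) &
    W 1 - W 0 = V 1 - V 0.
  elim: n => [|n [W dW WE]]; first by exists V.
  have [W' dW'] := dom_continuous_primitive (@iter_transfer_continuous _ _ _ n.+1 fB cf).
  exists W' => //; rewrite -WE.
  exact: transfer_integral (@iter_transfer_bounded _ _ _ n fB) dW dW'.
pose g := iter n transfer f.
(* Comparing [W] with a multiple of [ln (1 + x)] turns the deviation of [g s] from the mean into a
   difference of two values of [g]. *)
have dG (t : R) : 0 <= t <= 1 ->
    is_derive t 1 (fun x => g s * ln (1 + x) - W x) ((g s - g t) / (1 + t)).
  move=> /andP[t0 t1]; have t10 : 0 < 1 + t by lra.
  have dl := derZ (f := fun x : R => ln (1 + x)) (k := g s) (der_ln_addl t10) erefl.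
  by apply: (derB (f := fun x => g s * ln (1 + x)) dl (dW t t0)); rewrite mulrBl.
have [c /andP[c0 c1]] := mean_value ltr01 dG.
rewrite subr0 mulr1 addr0 ln1 mulr0 sub0r => GE.
have -> : g s * ln 2 - (V 1 - V 0) = g s * ln (1 + 1) - W 1 - - W 0.
  by rewrite -WE -natr1; ring.
rewrite GE normrM [X in _ * X]gtr0_norm ?invr_gt0; last by lra.
rewrite ler_pdivrMr; last by lra.
have c01 : 0 <= c <= 1 by rewrite !ltW.
apply: (le_trans (iter_transfer_dist n fB fnd s01 c01)).
have f0 : `|f 0| <= B by apply: fB; lra.
have f1 : `|f 1| <= B by apply: fB; lra.
have B0 : 0 <= B by exact: le_trans f0.
apply: (@le_trans _ _ (2 * B / 2 ^+ n)).
  rewrite ler_wpM2r ?invr_ge0 ?exprn_ge0//.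
  by rewrite (le_trans (ler_normB _ _))//; lra.
by rewrite ler_peMr ?divr_ge0 ?exprn_ge0//; [rewrite mulr_ge0|lra].
Qed.

End gauss_integral.

(** * Frequency of a set of digits *)

Section digit_set.
Context {R : realType}.
Variable b : nat -> bool.
Implicit Types (s : R).

Definition digit_freq s : R := digit_mean s (fun k => (b k)%:R).

Lemma bounded_by_ind : bounded_by 1 (fun k => (b k)%:R : R).
Proof. by move=> k; case: (b k); rewrite ?normr1 ?normr0. Qed.

Lemma digit_freq_bounded : dom_bounded 1 digit_freq.
Proof.
by apply: (@digit_mean_bounded R 1 (fun k _ => (b k)%:R)) => k s _; exact: bounded_by_ind.
Qed.

Lemma digit_freq_continuous : dom_continuous digit_freq.
Proof.
apply: (@digit_mean_continuous R 1 (fun k _ => (b k)%:R)) => k s _.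
  exact: bounded_by_ind.
exact: cvg_cst.
Qed.

(* Only the probabilities of the digits 1 and 2 (indices 0 and 1) fail to be
   nondecreasing in [s]. *)
Lemma digit_prob_nd k : (2 <= k)%N -> nondecreasing01 (fun s : R => digit_prob s k).
Proof.
move=> k2 x y x0 xy y1; have {}k2 : 2 <= k%:R :> R by rewrite (ler_nat R 2).
rewrite /digit_prob; set a := k%:R in k2 *.
have ax : 0 < (a + 1 + x) * (a + 2 + x) by rewrite mulr_gt0//; lra.
have ay : 0 < (a + 1 + y) * (a + 2 + y) by rewrite mulr_gt0//; lra.
rewrite ler_pdivrMr// mulrAC ler_pdivlMr//.
rewrite -subr_ge0 (_ : _ - _ =
  (y - x) * ((a + 1) * (a + 2) - (a + 1 + a + 2) - (x + y) - x * y)); last by ring.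
by rewrite mulr_ge0//; nra.
Qed.

Lemma digit_freq_nd : (forall k, b k -> (2 <= k)%N) -> nondecreasing01 digit_freq.
Proof.
move=> b2 x y x0 xy y1; have x1 : - 1 < x by lra.
have ym1 : - 1 < y by lra.
apply: ler_lim.
- by apply/cvg_ex; eexists; exact: (cvg_digit_mean x1 bounded_by_ind).
- by apply/cvg_ex; eexists; exact: (cvg_digit_mean ym1 bounded_by_ind).
apply: nearW => n; apply: ler_sum => k _.
case: (boolP (b k)) => [/b2 k2|_]; last by rewrite !mulr0.
by rewrite !mulr1; exact: digit_prob_nd.
Qed.

(** [ln (k%:R + 1 + s) - ln (k%:R + 2 + s)], a primitive of the term of index [k], increases over
    [0, 1] by the logarithm in the sum; so [l / ln 2] is the Gauss measure of the digit set. *)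
Lemma digit_freq_cvg (l : R) n s : (forall k, b k -> (2 <= k)%N) ->
  \sum_(k < n) (b k)%:R * ln ((k%:R + 2) ^+ 2 / ((k%:R + 1) * (k%:R + 3)))
    @[n --> \oo] --> l ->
  0 <= s <= 1 ->
  `|iter n transfer digit_freq s - l / ln 2| <= 2 / ln 2 / 2 ^+ n.
Proof.
move=> b2 sl s01.
have ln2 : (0 : R) < ln 2 by rewrite ln_gt0// ltr1n.
have [W dW] := dom_continuous_primitive digit_freq_continuous.
pose F k s : R := (b k)%:R * (ln (k%:R + 1 + s) - ln (k%:R + 2 + s)).
have vB k : dom_bounded 1 (fun _ : R => (b k)%:R) by move=> ? _; exact: bounded_by_ind.
have dF k (t : R) : 0 <= t -> is_derive t 1 (F k) (digit_prob t k * (b k)%:R / (1 + t)).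
  move=> t0; have k0 := ler0n R k.
  have k1t : 0 < k%:R + 1 + t by lra.
  have k2t : 0 < k%:R + 2 + t by lra.
  have dl := derB (f := fun x => ln (k%:R + 1 + x)) (g := fun x => ln (k%:R + 2 + x))
    (der_ln_addl k1t) (der_ln_addl k2t) erefl.
  apply: (derZ dl).
  rewrite /digit_prob; field.
  by do ?[apply/andP; split]; rewrite gt_eqF//; lra.
have WE := digit_mean_integral vB dF dW.
have lE : W 1 - W 0 = l.
  apply: (@cvg_unique _ (@Rhausdorff R) _ _ _ _ WE).
  apply: cvg_trans sl; apply: near_eq_cvg; apply: nearW => m.
  apply: eq_bigr => k _; rewrite /F -mulrBr; congr (_ * _).
  have k0 := ler0n R k.
  rewrite ln_div ?posrE ?exprn_gt0 ?mulr_gt0//; [|lra..].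
  rewrite lnXn; last by lra.
  rewrite lnM ?posrE; [|lra..]; rewrite mulr2n.
  have -> : k%:R + 1 + 1 = k%:R + 2 :> R by clear; lra.
  have -> : k%:R + 2 + 1 = k%:R + 3 :> R by clear; lra.
  by rewrite !addr0; clear; ring.
have := iter_transfer_cvg n digit_freq_bounded digit_freq_continuous
  (digit_freq_nd b2) dW s01.
rewrite lE mulr1 => h.
rewrite -[2 / ln 2 / _]mulrAC ler_pdivlMr// -{2}(gtr0_norm ln2) -normrM mulrBl.
by rewrite divfK// gt_eqF.
Qed.

End digit_set.

(** * The product of the [1 + 1 / n ^ 2] *)

Section sinh_product.
Context {R : realType}.
Implicit Types (t x : R) (f g V : R -> R).

Definition primitive_of f V := forall x, 0 <= x -> is_derive x 1 V (f x).

Lemma primitive_le f g V (W : R -> R) x : 0 < x ->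
  primitive_of f V -> primitive_of g W ->
  (forall t, 0 < t < x -> f t <= g t) -> V x - V 0 <= W x - W 0.
Proof.
move=> x0 dV dW fg.
have [c cx] := @mean_value R (fun t => W t - V t) (fun t => g t - f t) 0 x x0
  (fun t h => derB (dW t (proj1 (andP h))) (dV t (proj1 (andP h))) erefl).
rewrite subr0 -subr_ge0 => E.
rewrite (_ : _ - _ = W x - V x - (W 0 - V 0)); last by clear; lra.
by rewrite E mulr_ge0// ?subr_ge0 ?fg// ltW.
Qed.

Lemma primitive_eq f V (W : R -> R) x : 0 < x ->
  primitive_of f V -> primitive_of f W -> V x - V 0 = W x - W 0.
Proof. by move=> x0 dV dW; apply: le_anti; rewrite !(primitive_le x0 _ _ (f := f) (g := f)). Qed.

Let h : R := pi / 2.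

Lemma h_gt0 : 0 < h. Proof. by rewrite divr_gt0// pi_gt0. Qed.

Lemma cosXS_primitive n f : (forall x, 0 <= x + 1 -> {for x, continuous f}) ->
  exists V, primitive_of (fun t => f t * cos t ^+ n) V.
Proof.
move=> cf; apply: (@primitive_exists R _ (- 1)); first by rewrite oppr_lt0.
move=> x x1; apply: cvgM; first by apply: cf; rewrite -lerBlDr sub0r.
by apply: (@continuous_comp _ _ _ cos (fun y => y ^+ n));
  [exact: continuous_cos|exact: exprn_continuous].
Qed.

(* Integrates the derivative of [g cos^m + m f cos^(m-1) sin], [m = n + 2], a
   function that vanishes at 0 and at [pi / 2]. *)
Lemma cos_power_rec (a : R) f g V (W : R -> R) n :
  (forall x, is_derive x 1 f (g x)) -> (forall x, is_derive x 1 g (a * f x)) ->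
  g 0 = 0 ->
  primitive_of (fun t => f t * cos t ^+ n) V ->
  primitive_of (fun t => f t * cos t ^+ n.+2) W ->
  (a + n.+2%:R ^+ 2) * (W h - W 0) = n.+2%:R * n.+1%:R * (V h - V 0).
Proof.
move=> df dg g0 dV dW.
have dcosX m x : is_derive x 1 (fun t => cos t ^+ m.+1) (- (m.+1%:R * cos x ^+ m * sin x)).
  elim: m => [|m IH].
    rewrite (_ : (fun t => _) = cos); last by apply/funext.
    by apply: (is_derive_eq (is_derive_cos x)); rewrite expr0 !mul1r.
  under eq_fun do rewrite exprS.
  apply: (derM (is_derive_cos x) IH); rewrite -[m.+2%:R]natr1 exprS; ring.
pose P t := g t * cos t ^+ n.+2 + n.+2%:R * (f t * (cos t ^+ n.+1 * sin t)).
have dP : primitive_of (fun t => (a + n.+2%:R ^+ 2) * (f t * cos t ^+ n.+2) -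
    n.+2%:R * n.+1%:R * (f t * cos t ^+ n)) P.
  move=> x _; have d1 := derM (dg x) (dcosX n.+1 x) erefl.
  have d2 := derM (dcosX n x) (is_derive_sin x) erefl.
  have d3 := derZ (k := n.+2%:R) (derM (df x) d2 erefl) erefl.
  apply: (derD d1 d3).
  have sin2 : sin x * sin x = 1 - cos x * cos x by rewrite -!expr2 sin2cos2.
  rewrite ![cos x ^+ _.+1]exprS -![_.+1%:R]natr1.
  (* The unwanted terms are gathered in a multiple of [1 - cos x * cos x - sin x * sin x], which
     vanishes by [sin2]. *)
  rewrite [RHS](_ : _ = (a + (n%:R + 1 + 1) ^+ 2) * (f x * (cos x * (cos x * cos x ^+ n))) +
     (n%:R + 1 + 1) * (n%:R + 1) * f x * cos x ^+ n *
     (1 - cos x * cos x - sin x * sin x) - (n%:R + 1 + 1) * (n%:R + 1) * (f x * cos x ^+ n));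
    last by ring.
  by rewrite sin2; ring.
have dQ : primitive_of (fun t => (a + n.+2%:R ^+ 2) * (f t * cos t ^+ n.+2) -
    n.+2%:R * n.+1%:R * (f t * cos t ^+ n))
    (fun t => (a + n.+2%:R ^+ 2) * W t - n.+2%:R * n.+1%:R * V t).
  move=> x x0; exact: (derB (f := fun t => (a + n.+2%:R ^+ 2) * W t)
    (derZ (dW x x0) erefl) (derZ (dV x x0) erefl) erefl).
have Ph : P h = 0 by rewrite /P /h cos_pihalf !exprS !mul0r !mulr0 addr0.
have P0 : P 0 = 0 by rewrite /P g0 sin0 !mul0r !mulr0 addr0.
have := primitive_eq h_gt0 dP dQ; rewrite Ph P0 subrr => E.
apply/eqP; rewrite -subr_eq0; apply/eqP; rewrite [RHS]E /=.
set A := n.+2%:R; set B := n.+1%:R; clear; ring.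
Qed.

(* [cosh (2 t) - 1 = 2 sinh t ^ 2] is at most a multiple of [sin t ^ 2] on
   [0, pi / 2], so the weights [cos t ^ n] make the ratio of the two integrals
   tend to the value of [cosh] at 0. *)
Lemma expR_sub_le_sin : exists2 C : R, 0 <= C &
  forall t, 0 < t < h -> expR (2 * t) + expR (- (2 * t)) - 2 <= C * sin t ^+ 2.
Proof.
(* Since [sin t = 2 sin (t / 2) cos (t / 2)] and the cosine is at least [cos (pi / 4)] on
   [0, pi / 4], the bound follows from [cos (pi / 4) ^ 2 = 1 / 2]. *)
have sin_ge t : 0 < t < h -> t / 2 <= sin t.
  move=> /andP[t0]; rewrite /h => th; pose x := t / 2; pose q : R := pi / 4.
  have pi0 := @pi_gt0 R.
  have qE : q *+ 2 = pi / 2 by rewrite /q mulr2n; clear; lra.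
  have tE : t = x *+ 2 by rewrite /x mulr2n; clear; lra.
  have x0 : 0 < x by rewrite /x; clear -t0; lra.
  have xq : x < q by rewrite /x /q; clear -th; lra.
  have qpi : q <= pi by rewrite /q; clear -pi0; lra.
  have q0 : 0 <= q by rewrite /q; clear -pi0; lra.
  have cq y : 0 <= y -> y <= q -> cos q <= cos y.
    move=> y0 yq; rewrite leNgt ltr_cos ?in_itv/= ?q0 ?y0//= ?(le_trans yq)//.
    by rewrite -leNgt.
  have c0 : 0 <= cos q.
    by rewrite cos_ge0_pihalf// /q; clear -pi0; apply/andP; split; lra.
  have c2 : cos q * cos q = 2^-1.
    have : 0 = cos q ^+ 2 *+ 2 - 1 by rewrite -cos_mulr2n qE cos_pihalf.
    by rewrite -expr2 -[cos q ^+ 2 *+ 2]mulr_natr; move: (cos q ^+ 2) => z zE; clear -zE; lra.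
  have [c /andP[cc0 ccx] sE] := mean_value x0 (fun y _ => is_derive_sin y).
  have cx : cos q * x <= sin x.
    rewrite -[sin x]subr0 -sin0 sE subr0 ler_wpM2r ?(ltW x0)//.
    by apply: cq; [exact: ltW|exact: ltW (lt_trans ccx xq)].
  rewrite [X in sin X]tE sin_mulr2n.
  apply: (@le_trans _ _ ((cos q * cos q * x) *+ 2)).
    by rewrite c2 -[leRHS]mulr_natr mulrAC mulVf// mul1r.
  apply: ler_wMn2r; rewrite -mulrA; apply: ler_pM => //; first exact: mulr_ge0 (ltW x0).
  by apply: cq; exact: ltW.
(* The quantity to bound is the square of [expR t - expR (- t)], whose derivative is at most
   [expR 2 + 1] on [0, 2]; moreover [t <= 2 * sin t]. *)
exists (4 * (expR 2 + 1) ^+ 2); first by rewrite mulr_ge0// sqr_ge0.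
move=> t tI; have /andP[t0 th] := tI.
have dE x : is_derive x 1 (fun t => expR t - expR (- t)) (expR x + expR (- x)).
  have dm := der_comp (is_derive_expR (- x)) (is_deriveNid x 1) erefl.
  by apply: (derB (is_derive_expR x) dm); rewrite mulrN1 opprK.
have [c /andP[c0 ct]] := mean_value t0 (fun t _ => dE t).
rewrite /= [t - 0]subr0 oppr0 subrr subr0 => E.
have c2 : c < 2 by rewrite (lt_trans ct)// (lt_trans th)// pihalf_lt2.
have ED : expR t - expR (- t) <= (expR 2 + 1) * t.
  rewrite E ler_wpM2r ?(ltW t0)// lerD// ?ler_expR ?(ltW c2)//.
  by rewrite -expR0 ler_expR oppr_le0 ltW.
have E0 : 0 <= expR t - expR (- t).
  by rewrite E; apply: mulr_ge0 (ltW t0); apply: addr_ge0; exact: expR_ge0.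
have -> : expR (2 * t) + expR (- (2 * t)) - 2 = (expR t - expR (- t)) ^+ 2.
  rewrite (_ : 2 * t = t + t) ?opprD ?expRD; last by clear; ring.
  have : expR t * expR (- t) = 1 by rewrite -expRD subrr expR0.
  by move: (expR t) (expR (- t)) => a b ab; rewrite sqrrB ab !expr2; ring.
have st := sin_ge _ tI.
have D0 : 0 <= expR 2 + 1 :> R by apply: addr_ge0 => //; exact: expR_ge0.
have D2 : expR t - expR (- t) <= (expR 2 + 1) * (2 * sin t).
  by rewrite (le_trans ED)// ler_wpM2l//; clear -st; lra.
apply: (@le_trans _ _ (((expR 2 + 1) * (2 * sin t)) ^+ 2)).
  by rewrite !expr2 ler_pM.
by rewrite !exprMn; clear; lra.
Qed.

(** Twice the hyperbolic cosine of [2 * t]; [sinh2] is its derivative. The scale 2 gives [a = 4] in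
    [cos_power_rec], so that for the exponent [2 m] the factor [a + (2 m) ^ 2] is
    [4 m ^ 2 (1 + 1 / m ^ 2)]. *)
Definition cosh2 t := expR (2 * t) + expR (- (2 * t)).
Definition sinh2 t := 2 * (expR (2 * t) - expR (- (2 * t))).

Lemma der_expR_scale (k x : R) : is_derive x 1 (fun t => expR (k * t)) (k * expR (k * x)).
Proof.
have dk := derZ (k := k) (is_derive_id x 1) erefl.
by apply: (der_comp (is_derive_expR (k * x)) dk); rewrite mulr1 mulrC.
Qed.

Lemma der_cosh2 x : is_derive x 1 cosh2 (sinh2 x).
Proof.
rewrite /cosh2; under eq_fun do rewrite -mulNr.
by apply: (derD (der_expR_scale 2 x) (der_expR_scale (- 2) x)); rewrite mulNr mulNr -mulrBr.
Qed.

Lemma der_sinh2 x : is_derive x 1 sinh2 (4 * cosh2 x).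
Proof.
rewrite /sinh2; under eq_fun do rewrite -mulNr.
have d := derB (der_expR_scale 2 x) (der_expR_scale (- 2) x) erefl.
by apply: (derZ d); rewrite /cosh2 !mulNr; ring.
Qed.

Lemma cosh2_ge2 t : 2 <= cosh2 t.
Proof.
have : expR (2 * t) * expR (- (2 * t)) = 1 by rewrite -expRD subrr expR0.
have := expR_gt0 (2 * t); have := expR_gt0 (- (2 * t)); rewrite /cosh2.
by move: (expR _) (expR _) => a b a0 b0 ab; have := sqr_ge0 (a - b); rewrite expr2; nra.
Qed.

(** With [u n] and [w n] the integrals of [cosh2 t * cos t ^+ n.*2] and [cos t ^+ n.*2] over
    [0, pi / 2], the two recurrences differ only by the factor [1 + 1 / (n + 1) ^ 2]. Hence the
    product is [(u 0 / w 0) / (u n / w n)], and [u n / w n] tends to 2, the value of [cosh2] at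
    0. *)
Lemma prod_inv_squares_cvg :
  \prod_(j < n) (1 + (j.+1%:R ^+ 2)^-1) @[n --> \oo] -->
    ((expR pi - expR (- pi)) / (2 * pi) : R).
Proof.
have /choice[V dV] : forall n, exists V, primitive_of (fun t => cosh2 t * cos t ^+ n) V.
  by move=> n; apply: cosXS_primitive => x _; exact: der_continuous (der_cosh2 x).
have /choice[W dW] : forall n, exists W, primitive_of (fun t => 1 * cos t ^+ n) W.
  by move=> n; apply: (@cosXS_primitive n (fun=> 1)) => x _; exact: cvg_cst.
pose u n := V n.*2 h - V n.*2 0; pose w n := W n.*2 h - W n.*2 0.
pose N n : R := n.+1%:R.
have N0 n : 0 < N n by rewrite ltr0n.
have double2 n : n.*2.+2%:R = 2 * N n :> R.
  by rewrite -doubleS -muln2 natrM mulrC.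
have double1 n : n.*2.+1%:R = 2 * N n - 1 :> R.
  by apply: (addIr 1); rewrite natr1 double2 subrK.
pose kappa n : R := (2 * N n - 1) / (2 * N n).
have urec n : (1 + (N n ^+ 2)^-1) * u n.+1 = kappa n * u n.
  have := cos_power_rec der_cosh2 der_sinh2 _ (dV n.*2) (dV n.*2.+2).
  rewrite {1}/sinh2 mulr0 oppr0 subrr mulr0 => /(_ erefl).
  rewrite -doubleS -/(u n) -/(u n.+1) doubleS double2 double1 /kappa.
  move: (u n) (u n.+1) (N n) (N0 n) => x y m m0 E.
  have -> : (1 + (m ^+ 2)^-1) * y = (4 + (2 * m) ^+ 2) * y / (4 * m ^+ 2).
    by field; rewrite gt_eqF.
  by rewrite E; field; rewrite gt_eqF.
have wrec n : w n.+1 = kappa n * w n.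
  have d1 (x : R) : is_derive x 1 (fun=> 1 : R) 0 by exact: is_derive_cst.
  have d0 (x : R) : is_derive x 1 (fun=> 0 : R) (0 * 1) by rewrite mul0r; exact: is_derive_cst.
  have := cos_power_rec d1 d0 erefl (dW n.*2) (dW n.*2.+2).
  rewrite -doubleS -/(w n) -/(w n.+1) doubleS double2 double1 /kappa.
  move: (w n) (w n.+1) (N n) (N0 n) => x y m m0 E.
  have -> : y = (0 + (2 * m) ^+ 2) * y / (4 * m ^+ 2) by field; rewrite gt_eqF.
  by rewrite E; field; rewrite gt_eqF.
have w0 : w 0 = h.
  have did : primitive_of (fun t => 1 * cos t ^+ 0) id.
    by move=> x _; rewrite expr0 mulr1; exact: is_derive_id.
  by rewrite /w (primitive_eq h_gt0 (dW 0%N) did) subr0.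
have u0 : u 0 = (expR pi - expR (- pi)) / 2.
  have dsh : primitive_of (fun t => cosh2 t * cos t ^+ 0) (fun t => 4^-1 * sinh2 t).
    by move=> x _; apply: (derZ (der_sinh2 x)); rewrite expr0 mulr1 mulKf.
  rewrite /u (primitive_eq h_gt0 (dV 0%N) dsh) /sinh2 mulr0 oppr0 subrr !mulr0 subr0.
  have -> : 2 * h = pi by rewrite /h mulrC divfK.
  by clear; lra.
have w_gt0 n : 0 < w n.
  elim: n => [|n IH]; first by rewrite w0 h_gt0.
  rewrite wrec mulr_gt0// divr_gt0 ?mulr_gt0//.
  have : 1 <= N n by rewrite ler1n.
  by move: (N n) => m m1; clear -m1; lra.
have uw n : u n * (\prod_(j < n) (1 + (j.+1%:R ^+ 2)^-1)) * w 0 = u 0 * w n.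
  elim: n => [|n IH]; first by rewrite big_ord0 mulr1.
  rewrite big_ord_recr/= wrec -[n.+1%:R]/(N n).
  rewrite (_ : _ * w 0 = (1 + (N n ^+ 2)^-1) * u n.+1 *
    (\prod_(j < n) (1 + (j.+1%:R ^+ 2)^-1)) * w 0); last by ring.
  by rewrite urec -2!mulrA [u n * _]mulrA IH mulrCA.
have [C C0 CE] := expR_sub_le_sin.
have cosn0 n t : 0 < t < h -> 0 <= cos t ^+ n.
  move=> /andP[t0 th]; rewrite exprn_ge0// cos_ge0_pihalf//.
  by apply/andP; split; [rewrite (le_trans _ (ltW t0))// oppr_le0 ltW// h_gt0|exact: ltW].
have ul n : 2 * w n <= u n.
  have d2 : primitive_of (fun t => 2 * (1 * cos t ^+ n.*2)) (fun t => 2 * W n.*2 t).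
    by move=> x x0; exact: derZ (dW _ x x0) erefl.
  rewrite /w mulrBr; apply: (primitive_le h_gt0 d2 (dV _)) => t tI.
  by rewrite mul1r ler_wpM2r ?cosn0// cosh2_ge2.
(* [cosh2 t - 2] is at most [C * (1 - cos t ^+ 2)], whose weighted integral is [C * (w n - w n.+1)];
   by [wrec] that difference is [w n / (2 (n + 1))]. *)
have uu n : u n <= 2 * w n + C * (w n - w n.+1).
  pose F t := 2 * W n.*2 t + C * (W n.*2 t - W n.*2.+2 t).
  have dF : primitive_of (fun t => 2 * (1 * cos t ^+ n.*2) +
      C * (1 * cos t ^+ n.*2 - 1 * cos t ^+ n.*2.+2)) F.
    move=> x x0; have d1 := derZ (k := 2) (dW n.*2 x x0) erefl.
    have d2 := derZ (k := C) (derB (dW n.*2 x x0) (dW n.*2.+2 x x0) erefl) erefl.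
    exact: (derD d1 d2 erefl).
  have -> : 2 * w n + C * (w n - w n.+1) = F h - F 0.
    by rewrite /F /w doubleS; clear; ring.
  apply: (primitive_le h_gt0 (dV _) dF) => t tI.
  have := CE t tI; rewrite -/(cosh2 t) sin2cos2 => ce.
  have := cosn0 n.*2 t tI; rewrite !exprS.
  by move: (cos t ^+ n.*2) ce; clear => z; rewrite expr2; nra.
have ratio : u n / w n @[n --> \oo] --> (2 : R).
  apply: cvg_dist_le (cvg_harmonic_mul (C / 2)) => n.
  have -> : 2 - u n / w n = - ((u n - 2 * w n) / w n).
    by field; rewrite gt_eqF.
  rewrite normrN normrM [X in _ * X]gtr0_norm ?invr_gt0//.
  rewrite ler_pdivrMr// ger0_norm ?subr_ge0//.
  rewrite lerBlDl (le_trans (uu n))// lerD2l wrec /kappa -[n.+1%:R]/(N n).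
  rewrite le_eqVlt; apply/orP; left; apply/eqP.
  by have := N0 n; move: (N n) (w n) => m z m0; field; rewrite gt_eqF.
have h0 := h_gt0.
have -> : (fun n => \prod_(j < n) (1 + (j.+1%:R ^+ 2)^-1)) =
    (fun n => u 0 / w 0 * (u n / w n)^-1 : R).
  apply/funext => n; have un : 0 < u n.
    by apply: lt_le_trans (ul n); rewrite mulr_gt0.
  have := uw n; move: (\prod_(j < n) _) => p pE.
  apply: (@mulfI _ (u n * w 0)); first by rewrite mulf_neq0 ?gt_eqF.
  rewrite mulrAC pE; field.
  by rewrite !gt_eqF.
have -> : (expR pi - expR (- pi)) / (2 * pi) = u 0 / w 0 * 2^-1.
  rewrite u0 w0 /h; have pi0 : pi != 0 :> R by rewrite gt_eqF// pi_gt0.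
  move: (expR pi - expR (- pi)) => x; move: (@pi R) pi0 => p p0.
  by field.
apply: cvgM; first exact: cvg_cst.
by apply: cvgV.
Qed.

End sinh_product.

(* [k] is the index of the digit [k + 1 = n ^ 2 - 1]. *)
Definition square_index (k : nat) : bool := `[< exists n : nat, k.+2 = (n.+2 ^ 2)%N >].

Lemma square_index_ge2 k : square_index k -> (2 <= k)%N.
Proof. by move/asboolP => [n]; rewrite !expnS expn0; nia. Qed.

(** * Total weight of the digits [n ^ 2 - 1] *)

Section square_digits.
Context {R : realType}.

(** [ln 2] times the Gauss-Kuzmin probability of the digit [k + 1]. *)
Definition digit_weight (k : nat) : R :=
  ln ((k%:R + 2) ^+ 2 / ((k%:R + 1) * (k%:R + 3))).

Lemma digit_weight_ge0 k : 0 <= digit_weight k.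
Proof.
have k0 := ler0n R k; rewrite ln_ge0// ler_pdivlMr ?mul1r; nra.
Qed.

(** Among the indices from [(m.+2 ^ 2).-2] up to [(m.+3 ^ 2).-2] excluded, only the first is a
    square index, so each induction step adds one weight. *)
Lemma sum_square_weight m :
  \sum_(k < (m.+2 ^ 2).-2) (square_index k)%:R * digit_weight k =
  \sum_(j < m) digit_weight (j.+2 ^ 2).-2.
Proof.
elim: m => [|m IH].
  rewrite big_ord0 big1// => -[k /= k2] _.
  by case: (boolP (square_index k)) => [/square_index_ge2|_]; [lia|rewrite mul0r].
rewrite [RHS]big_ord_recr/= -IH -!(big_mkord predT (fun k => (square_index k)%:R * digit_weight k)).
have le1 : ((m.+2 ^ 2).-2 <= (m.+3 ^ 2).-2)%N by rewrite !expnS expn0; lia.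
rewrite (big_cat_nat (n := (m.+2 ^ 2).-2))//=; congr (_ + _).
have lt1 : ((m.+2 ^ 2).-2 < (m.+3 ^ 2).-2)%N by rewrite !expnS expn0; lia.
rewrite big_ltn// (_ : square_index _ = true) ?mul1r; last first.
  by apply/asboolP; exists m; rewrite !expnS expn0; lia.
rewrite big_nat_cond big1 ?addr0// => k /andP[/andP[k1 k2] _].
case: (boolP (square_index k)) => [/asboolP[n kn]|_]; last by rewrite mul0r.
have : (m < n < m.+1)%N by move: k1 k2 kn; rewrite !expnS expn0; nia.
by lia.
Qed.

Lemma digit_weight_square (x : nat) : (2 <= x)%N ->
  digit_weight (x ^ 2).-2 = ln (x%:R ^+ 4 / (x%:R ^+ 4 - 1)).
Proof.
move=> x2; rewrite /digit_weight.
have E : (x ^ 2).-2%:R = x%:R ^+ 2 - 2 :> R.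
  apply: (addIr 2); rewrite subrK -natrX -(natrD _ _ 2); congr (_%:R).
  by move: x2; rewrite !expnS expn0; nia.
by rewrite E; congr (ln (_ / _)); ring.
Qed.

(** Each factor is [x ^ 2 / (x ^ 2 - 1)] divided by [1 + 1 / x ^ 2]. The quotients telescope to
    [2 (m + 1) / (m + 2)]; the other factor 2 of the constant 4 compensates for the term [j = 0] of
    the product on the right. *)
Lemma prod_fourth m :
  \prod_(j < m) (j.+2%:R ^+ 4 / (j.+2%:R ^+ 4 - 1)) =
  4 * (m.+1%:R / m.+2%:R) / \prod_(j < m.+1) (1 + (j.+1%:R ^+ 2)^-1) :> R.
Proof.
elim: m => [|m IH].
  by rewrite big_ord0 big_ord_recl big_ord0/= expr1n invr1; field.
rewrite big_ord_recr IH/= [in RHS]big_ord_recr/=.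
have : 0 < \prod_(j < m.+1) (1 + (j.+1%:R ^+ 2)^-1) :> R.
  by apply: prodr_gt0 => j _; rewrite addr_gt0// invr_gt0 exprn_gt0.
move: (\prod_(j < m.+1) _) => p p0.
rewrite -[m.+3%:R]natr1 -[m.+2%:R]natr1; have : (0 : R) < m.+1%:R by rewrite ltr0n.
move: (m.+1%:R : R) => x x0.
have x41 : (x + 1) ^+ 4 - 1 = x * (x + 2) * ((x + 1) ^+ 2 + 1) by ring.
rewrite x41; field.
by rewrite !gt_eqF// ?addr_gt0 ?exprn_gt0// addr_gt0.
Qed.

(** The weights are nonnegative, so the partial sums increase and it is enough to have convergence
    along the indices [N m], where [prod_fourth] evaluates them. *)
Lemma sum_square_weight_cvg :
  \sum_(k < n) (square_index k)%:R * digit_weight k @[n --> \oo] -->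
    ln (8 * pi / (expR pi - expR (- pi)) : R).
Proof.
set s := fun n => \sum_(k < n) (square_index k)%:R * digit_weight k.
have s_nd : nondecreasing_seq s.
  apply/nondecreasing_seqP => n; rewrite /s big_ord_recr/= lerDl mulr_ge0//.
  exact: digit_weight_ge0.
pose N m := (m.+2 ^ 2).-2.
have den0 : 0 < expR pi - expR (- pi) :> R.
  by rewrite subr_gt0 ltr_expR gtrN// pi_gt0.
have sN : (fun m => s (N m)) = (fun m => ln (4 * (m.+1%:R / m.+2%:R) /
    \prod_(j < m.+1) (1 + (j.+1%:R ^+ 2)^-1))).
  apply/funext => m; rewrite /s /N sum_square_weight -prod_fourth.
  elim: m => [|m IH]; first by rewrite !big_ord0 ln1.
  have f0 j : 0 < (j.+2%:R ^+ 4 / (j.+2%:R ^+ 4 - 1) : R).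
    by rewrite divr_gt0 ?exprn_gt0 ?subr_gt0 ?exprn_egt1// ltr1n.
  rewrite !big_ord_recr/= IH lnM ?posrE ?prodr_gt0//.
  by rewrite -digit_weight_square.
have sN_cvg : s (N m) @[m --> \oo] --> ln (8 * pi / (expR pi - expR (- pi)) : R).
  rewrite sN; apply: (@cvg_comp _ _ _ _ (@ln R)); last first.
    by apply: continuous_ln; rewrite divr_gt0// mulr_gt0// pi_gt0.
  have -> : 8 * pi / (expR pi - expR (- pi)) =
      4 * 1 / ((expR pi - expR (- pi)) / (2 * pi)) :> R.
    have pi0 : pi != 0 :> R by rewrite gt_eqF// pi_gt0.
    move: (expR pi - expR (- pi)) den0 => x x0; move: (@pi R) pi0 => p p0.
    by field; rewrite p0/= gt_eqF.
  apply: cvgM.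
    apply: cvgM; first exact: cvg_cst.
    apply: cvg_dist_le (cvg_harmonic_mul 1) => n.
    rewrite -[n.+2%:R]natr1; have : (0 : R) < n.+1%:R by rewrite ltr0n.
    move: (n.+1%:R : R) => x x0.
    have -> : 1 - x / (x + 1) = (x + 1)^-1 by field; rewrite gt_eqF// addr_gt0.
    by rewrite gtr0_norm ?invr_gt0 ?addr_gt0// mul1r lef_pV2 ?posrE ?addr_gt0// lerDl.
  apply: cvgV; first by rewrite gt_eqF// divr_gt0// mulr_gt0// pi_gt0.
  have := @prod_inv_squares_cvg R; rewrite -(cvg_shiftS (fun n => \prod_(j < n) (1 + (j.+1%:R ^+ 2)^-1) : R)).
  by [].
have N_ge n : (n <= N n)%N by rewrite /N !expnS expn0; lia.
have N_nd : {homo N : m n / (m <= n)%N}.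
  by move=> m n mn; rewrite /N !expnS expn0; nia.
have s_le n : s n <= ln (8 * pi / (expR pi - expR (- pi)) : R).
  apply: (le_trans (s_nd _ _ (N_ge n))).
  have snd : nondecreasing_seq (fun m => s (N m)) by move=> i j ij; apply/s_nd/N_nd.
  rewrite -(cvg_lim (@Rhausdorff R) sN_cvg).
  by apply: (nondecreasing_cvgn_le snd); apply/cvg_ex; eexists; exact: sN_cvg.
apply/cvgrPdist_le => e e0.
move/cvgrPdist_le : sN_cvg => /(_ e e0)[m _ /(_ m (leqnn m))/= me].
exists (N m) => // n /= mn.
move: me; rewrite !ger0_norm ?subr_ge0//; apply: le_trans.
by rewrite lerB// s_nd.
Qed.

End square_digits.

(** * Cylinders and large deviations *)

Section cylinders.
Context {R : realType}.
Variable phi : nat -> R.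
Local Notation mu := (@lebesgue_measure R).

(* The cylinder of state [(p, p', s)] is the set of all
   [(p z + p') / (z + s)], [z >= 1]: [p] is its last convergent, and [s] the
   ratio of its last two denominators.  Appending the digit [k + 1] amounts to
   the substitution [z := k + 1 + z^-1]. *)
Definition cylinder (p p' s : R) : set R :=
  let d := (p' - p * s) / (1 + s) in `[p + Num.min 0 d, p + Num.max 0 d]%classic.

(** Union of the cylinders that extend the state by [n] digits whose values of [phi] sum to at least
    [y]; [y] is the part of the threshold still to be reached. *)
Fixpoint deviation_set n (p p' s y : R) : set R :=
  if n is m.+1 then
    \bigcup_k deviation_set m ((p * (k%:R + 1) + p') / (k%:R + 1 + s))
      (p / (k%:R + 1 + s)) (k%:R + 1 + s)^-1 (y - phi k)
  else if y <= 0 then cylinder p p' s else set0.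

Lemma measurable_deviation_set n p p' s y : measurable (deviation_set n p p' s y).
Proof.
elim: n p p' s y => [|n IH] p p' s y /=.
  by case: ifP => _; [exact: measurable_itv|exact: measurable0].
by apply: bigcup_measurable => k _; exact: IH.
Qed.

Definition gauss_index (z : R) i : nat := `|gauss_digits z i|.-1.

Lemma gauss_indexS z i : gauss_index z i.+1 = gauss_index (gauss z) i.
Proof. by rewrite /gauss_index -gauss_digitsS. Qed.

Lemma gauss_index0 z : 1 < z -> z = (gauss_index z 0)%:R + 1 + (gauss z)^-1.
Proof.
move=> z1; rewrite {1}(gaussE z); congr (_ + _).
have := floor_irrational_gt0 z1; rewrite /gauss_index /gauss_digits /=.
by case: (Num.floor z) => // -[|m]// _; rewrite natr1.
Qed.

(** Writing [z = k + 1 + w^-1], with [w] the next tail, brings the point to the same form for the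
    state after the digit [k + 1]. Irrationality keeps every tail above 1. *)
Lemma mem_deviation_set n p p' s y z : irrational z -> 1 < z -> 0 <= s ->
  y <= \sum_(i < n) phi (gauss_index z i) ->
  deviation_set n p p' s y ((p * z + p') / (z + s)).
Proof.
elim: n p p' s y z => [|n IH] p p' s y z iz z1 s0.
  rewrite big_ord0 /= => ->; rewrite /cylinder.
  set d := (p' - p * s) / (1 + s).
  have -> : (p * z + p') / (z + s) = p + d * ((1 + s) / (z + s)).
    by rewrite /d; field; rewrite !gt_eqF//; lra.
  have : 0 <= (1 + s) / (z + s) <= 1.
    by rewrite divr_ge0 ?ler_pdivrMr ?mul1r//=; lra.
  move: ((1 + s) / _) d => a d /andP[a0 a1].
  rewrite /= in_itv/= !lerD2l; case: (leP 0 d) => d0.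
    by rewrite mulr_ge0//= ler_piMr.
  have {}d0 := ltW d0; rewrite mulr_le0_ge0// andbT.
  by rewrite -{1}[d]mulr1 ler_wnM2l.
rewrite big_ord_recl /= => yz; have w1 := gauss_gt1 iz.
exists (gauss_index z 0) => //.
have zE := gauss_index0 z1; move: yz.
rewrite -lerBlDl => yz.
have -> : (p * z + p') / (z + s) =
    ((p * ((gauss_index z 0)%:R + 1) + p') / ((gauss_index z 0)%:R + 1 + s) * gauss z +
     p / ((gauss_index z 0)%:R + 1 + s)) /
    (gauss z + ((gauss_index z 0)%:R + 1 + s)^-1).
  have k0 := ler0n R (gauss_index z 0).
  rewrite {1 2}zE; move: (_%:R) (gauss z) w1 k0 => k w w1 k0.
  field.
  by do ?[apply/andP; split]; rewrite gt_eqF//; nra.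
apply: IH => //; first exact: gauss_irrational.
  by rewrite invr_ge0; have := ler0n R (gauss_index z 0); lra.
by under eq_bigr do rewrite -gauss_indexS.
Qed.

Variables (G : R -> R) (rho : R).
Hypothesis rho0 : 0 <= rho.
Hypothesis G1 : forall s, 0 <= s <= 1 -> 1 <= G s.
Hypothesis Gphi : forall s n, 0 <= s <= 1 ->
  digit_psum s (fun k => expR (phi k) * G (k%:R + 1 + s)^-1) n <= rho * G s.

(** Chernoff bound by induction on [n]: a cylinder has length [|p' - p s| / (1 + s)], appending the
    digit [k + 1] multiplies it by [digit_prob s k], and [Gphi] absorbs the sum over [k]. For
    [n = 0] the set is empty unless [y <= 0], and then [expR (- y)] and [G s] are at least 1. *)
Lemma deviation_set_measure n p p' s y : 0 <= s <= 1 ->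
  (mu (deviation_set n p p' s y) <=
   (expR (- y) * rho ^+ n * G s * (`|p' - p * s| / (1 + s)))%:E)%E.
Proof.
elim: n p p' s y => [|n IH] p p' s y s01; have /andP[s0 s1] := s01.
  rewrite /= expr0 mulr1; have G1s := G1 s01.
  have b0 : 0 <= expR (- y) * G s * (`|p' - p * s| / (1 + s)).
    by rewrite mulr_ge0 ?divr_ge0 ?mulr_ge0 ?expR_ge0//; lra.
  case: ifPn => y0; last by rewrite measure0 lee_fin.
  rewrite /cylinder lebesgue_measure_itv/=.
  set d := (p' - p * s) / (1 + s).
  have dE : `|p' - p * s| / (1 + s) = `|d|.
    by rewrite /d normrM [`|_^-1|]gtr0_norm// invr_gt0; lra.
  case: ifP => _; last by rewrite lee_fin.
  rewrite -EFinB lee_fin dE opprD addrACA subrr add0r.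
  have -> : Num.max 0 d - Num.min 0 d = `|d|.
    by case: (leP 0 d) => d0; [rewrite subr0 ger0_norm|rewrite sub0r ltr0_norm].
  rewrite ler_peMl// -[1]mulr1 ler_pM//.
  by rewrite -expR0 ler_expR oppr_ge0.
pose F k := deviation_set n ((p * (k%:R + 1) + p') / (k%:R + 1 + s))
  (p / (k%:R + 1 + s)) (k%:R + 1 + s)^-1 (y - phi k).
have mF k : measurable (F k) by exact: measurable_deviation_set.
apply: (@le_trans _ _ (\sum_(k <oo) mu (F k))%E).
  have mU : measurable (\bigcup_k F k) by apply: bigcup_measurable => k _; exact: mF.
  exact: (@measure_sigma_subadditive _ _ _ (@lebesgue_measure R) _ F mF mU (subset_refl _)).
pose c := expR (- y) * rho ^+ n * (`|p' - p * s| / (1 + s)).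
have c0 : 0 <= c.
  by rewrite !mulr_ge0 ?expR_ge0 ?exprn_ge0// invr_ge0; lra.
have term k : (mu (F k) <=
    (c * (digit_prob s k * (expR (phi k) * G (k%:R + 1 + s)^-1)))%:E)%E.
  have k0 := ler0n R k.
  have b01 : 0 <= (k%:R + 1 + s)^-1 <= 1.
    by rewrite branch_le1// ltW// branch_gt0//; lra.
  apply: (le_trans (IH _ _ _ _ b01)); rewrite lee_fin le_eqVlt; apply/orP; left.
  have ks : 0 < k%:R + 1 + s by lra.
  have -> : p / (k%:R + 1 + s) - (p * (k%:R + 1) + p') / (k%:R + 1 + s) / (k%:R + 1 + s) =
      - (p' - p * s) / (k%:R + 1 + s) ^+ 2.
    by field; rewrite gt_eqF.
  rewrite mulNr normrN normrM [`|_^-1|]gtr0_norm ?invr_gt0 ?exprn_gt0//.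
  rewrite opprB expRD /c /digit_prob; apply/eqP.
  move: (expR _) (expR _) (rho ^+ n) (G _) `|_| => e1 e2 r g a; field.
  by do ?[apply/andP; split]; rewrite gt_eqF//; nra.
apply: (le_trans (lee_nneseries _ (fun k _ => term k))) => //.
apply: lime_le.
  apply: is_cvg_nneseries => k _ _; apply: le_trans (term k).
  exact: measure_ge0.
apply: nearW => m; rewrite sumEFin lee_fin big_mkord -mulr_sumr.
have -> : expR (- y) * rho ^+ n.+1 * G s * (`|p' - p * s| / (1 + s)) = c * (rho * G s).
  by rewrite /c exprS; ring.
by rewrite ler_wpM2l//; exact: Gphi.
Qed.

End cylinders.

(** * The Lyapunov function *)

Section lyapunov.
Context {R : realType}.
Implicit Types (s : R).

(** [expR y] is at most [1 / (1 - y)], and [(1 - y) (1 + y + 2 y ^ 2) = 1 + y ^ 2 (1 - 2 y)] is at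
    least 1. *)
Lemma expR_le_quadratic (y : R) : y <= 2^-1 -> expR y <= 1 + y + 2 * y ^+ 2.
Proof.
move=> y2; have := expR_ge1Dx (- y); rewrite expRN => e.
have e0 := expR_gt0 y; have : (1 - y) * expR y <= 1.
  by rewrite -ler_pdivlMr// mul1r.
move: (expR y) e0 => z z0; rewrite expr2; nra.
Qed.

Lemma digit_psum_le_mean s B (v : nat -> R) n : - 1 < s -> bounded_by B v ->
  (forall k, 0 <= v k) -> digit_psum s v n <= digit_mean s v.
Proof.
move=> s1 vB v0; apply: nondecreasing_cvgn_le.
  apply/nondecreasing_seqP => m; rewrite /digit_psum big_ord_recr/= lerDl.
  by rewrite mulr_ge0// ltW// digit_prob_gt0.
by apply/cvg_ex; eexists; exact: cvg_digit_mean s1 vB.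
Qed.

(** The errors [z] and [x] consume at most half of the drift [w]; what remains covers [w / 4] times
    [1 + y]. *)
Lemma drift_le (w z x y : R) : 0 <= w -> z <= w / 4 -> x <= w / 4 -> y <= 4^-1 ->
  1 - w + z + (y + x) <= (1 - w / 4) * (1 + y).
Proof. by move=> w0 zw xw y4; nra. Qed.

Variables (b : nat -> bool) (c D : R).
Let f n : R -> R := iter n transfer (digit_freq b).
Hypothesis f_cvg : forall n s, 0 <= s <= 1 -> `|f n s - c| <= D / 2 ^+ n.

(* Solves the Poisson equation [g - transfer g = f 0 - c] up to [f N - c]. *)
Let g N s : R := \sum_(j < N) (f j s - c).

Lemma f_bounded n : dom_bounded 1 (f n).
Proof. exact: iter_transfer_bounded (digit_freq_bounded b). Qed.

Lemma g_bounded N : dom_bounded (N%:R * (1 + `|c|)) (g N).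
Proof.
move=> s s1; rewrite /g (le_trans (ler_norm_sum _ _ _))//.
rewrite mulr_natl -[X in _ *+ X]card_ord -sumr_const ler_sum// => j _.
by rewrite (le_trans (ler_normB _ _))// lerD2r f_bounded.
Qed.

Lemma transfer_g N s : - 1 < s -> transfer (g N) s = \sum_(j < N) (f j.+1 s - c).
Proof.
move=> s1; elim: N => [|N IH].
  rewrite big_ord0 /transfer -[RHS](digit_mean_cst 0 s1); congr digit_mean.
  by apply/funext => k; rewrite /g big_ord0.
rewrite big_ord_recr/= -IH /transfer.
have gB := dom_bounded_branch (@g_bounded N) s1.
have fB : bounded_by (1 + `|c|) (fun k => f N (k%:R + 1 + s)^-1 - c).
  move=> k; rewrite (le_trans (ler_normB _ _))// lerD2r.
  exact: (dom_bounded_branch (@f_bounded N) s1).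
pose B := N%:R * (1 + `|c|) + (1 + `|c|).
have c0 : 0 <= 1 + `|c| by rewrite addr_ge0.
have gB' : bounded_by B (fun k => g N (k%:R + 1 + s)^-1).
  by move=> k; rewrite (le_trans (gB k))// lerDl.
have fB' : bounded_by B (fun k => f N (k%:R + 1 + s)^-1 - c).
  by move=> k; rewrite (le_trans (fB k))// lerDr mulr_ge0.
have cB : bounded_by (1 + `|c|) (fun=> - c) by move=> k; rewrite normrN lerDr.
have f1B : bounded_by (1 + `|c|) (fun k => f N (k%:R + 1 + s)^-1).
  by move=> k; rewrite (le_trans (dom_bounded_branch (@f_bounded N) s1 k))// lerDl.
have := digit_meanZD 1 s1 gB' fB'; rewrite mul1r.
have := digit_meanZD 1 s1 f1B cB; rewrite mul1r digit_mean_cst// => E1 E2.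
transitivity (digit_mean s (fun k => 1 * g N (k%:R + 1 + s)^-1 +
    (f N (k%:R + 1 + s)^-1 - c))).
  by congr digit_mean; apply/funext => k; rewrite /g big_ord_recr/= mul1r.
rewrite E2; congr (_ + _); rewrite -[RHS]E1; congr digit_mean.
by apply/funext => k; rewrite mul1r.
Qed.

(** [G] is a constant perturbed by a small multiple of [g N]. As [g N] nearly solves the Poisson
    equation, to first order in [theta] the weighted mean reproduces [G] with the drift
    [- theta * e]; the error from [f N - c] and the second-order terms each cost at most a quarter
    of the drift. The sign [sigma] serves for deviations in both directions. *)
Lemma lyapunov (sigma e : R) : `|sigma| = 1 -> 0 < e -> e <= 1 ->
  exists theta rho (G : R -> R), [/\ 0 < theta, 0 <= rho < 1,
    forall s, 0 <= s <= 1 -> 1 <= G s,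
    G 0 <= 4 &
    forall s n, 0 <= s <= 1 ->
      digit_psum s (fun k => expR (theta * (sigma * ((b k)%:R - c) - e)) *
        G (k%:R + 1 + s)^-1) n <= rho * G s].
Proof.
move=> sig e0 e1.
have [N _ /(_ N (leqnn _)) NE] : \forall n \near \oo, D / 2 ^+ n <= e / 4.
  have /cvgrPdist_le/(_ (e / 4)) := cvg_half_expn D.
  move=> /(_ _)[|N _ NE]; first by rewrite divr_gt0.
  exists N => // n /NE /=; rewrite sub0r normrN; apply: le_trans; exact: ler_norm.
(* [K] bounds [psi k - e], [M] bounds [g N], and [C0] collects the quadratic terms; [theta] is then
   chosen so that [theta * C0 <= e / 4] and [theta * K], [theta * M] are at most 1/4. *)
pose K := 2 + `|c|; pose M := N%:R * (1 + `|c|); pose C0 := 4 * K ^+ 2 + K * M.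
have c0 := normr_ge0 c.
have K2 : 2 <= K by rewrite lerDl.
have M0 : 0 <= M by rewrite mulr_ge0// addr_ge0.
have C00 : 0 <= C0 by rewrite /C0 expr2; nra.
pose L := C0 + K + M; have L0 : 0 < L by rewrite /L; lra.
pose theta := e / (4 * L).
have th0 : 0 < theta by rewrite divr_gt0// mulr_gt0.
have thL : theta * L = e / 4 by rewrite /theta; field; rewrite gt_eqF.
clearbody theta.
have thC : theta * C0 <= e / 4.
  by rewrite -thL ler_pM2l// /L; lra.
have thK : theta * K <= 4^-1.
  have : theta * K <= e / 4 by rewrite -thL ler_pM2l// /L; lra.
  by lra.
have thM : theta * M <= 4^-1.
  have : theta * M <= e / 4 by rewrite -thL ler_pM2l// /L; lra.
  by lra.
pose H s := 1 + theta * (sigma * g N s).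
have gM s : - 2^-1 < s -> `|theta * (sigma * g N s)| <= 4^-1.
  move=> s1; rewrite !normrM sig mul1r gtr0_norm//; apply: le_trans thM.
  by rewrite ler_pM2l// g_bounded.
(* [H] stays between 3/4 and 5/4, so the factor 2 lifts it above 1 and keeps [G 0] below 4. *)
exists theta, (1 - theta * e / 4), (fun s => 2 * H s).
have the : theta * e <= 1.
  have : theta * e <= theta * K by rewrite ler_pM2l//; lra.
  by lra.
have the0 : 0 < theta * e by rewrite mulr_gt0.
split=> //.
- by move: (theta * e) the the0 => w w1 w0; apply/andP; split; lra.
- move=> s /andP[s0 _]; have := @gM s; rewrite /H ler_norml => /(_ _)/andP[]; first lra.
  by move: (theta * _) => w; lra.
- have := @gM 0; rewrite /H ler_norml => /(_ _)/andP[]; first lra.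
  by move: (theta * _) => w; lra.
move=> s n s01; have /andP[s0 s1] := s01.
have sm1 : - 1 < s by lra.
have sd : - 2^-1 < s by lra.
pose psi k := sigma * ((b k)%:R - c).
pose E k := expR (theta * (psi k - e)) * H (k%:R + 1 + s)^-1.
pose gb k := g N (k%:R + 1 + s)^-1.
have psiB k : `|psi k| <= 1 + `|c|.
  rewrite normrM sig mul1r (le_trans (ler_normB _ _))// lerD2r.
  by case: (b k); rewrite ?normr1 ?normr0.
have psieB k : `|psi k - e| <= K.
  rewrite (le_trans (ler_normB _ _))// (gtr0_norm e0).
  by have := psiB k; rewrite /K; lra.
have gbB : bounded_by M gb by exact: (dom_bounded_branch (@g_bounded N) sm1).
have bm k : `|theta * (sigma * gb k)| <= 4^-1 by apply: gM; exact: branch_dom.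
have E0 k : 0 <= E k.
  rewrite mulr_ge0 ?expR_ge0//; have := bm k; rewrite ler_norml => /andP[+ _].
  by rewrite /H -/(gb k); move: (theta * _) => w; lra.
(* An upper bound for [E] that is affine in [psi] and [gb], so its mean can be computed. *)
pose T k := (1 - theta * e + theta ^+ 2 * C0) + theta * (psi k + sigma * gb k).
have ET k : E k <= T k.
  have y2 : `|theta * (psi k - e)| <= 2^-1.
    rewrite normrM gtr0_norm// (@le_trans _ _ (theta * K))//.
      by rewrite ler_pM2l.
    by lra.
  have yle : theta * (psi k - e) <= 2^-1 by rewrite (le_trans (ler_norm _)).
  have H0 : 0 <= 1 + theta * (sigma * gb k) <= 2.
    have := bm k; rewrite ler_norml => /andP[].
    by move=> ? ?; apply/andP; split; lra.
  have := expR_le_quadratic yle; have := expR_ge0 (theta * (psi k - e)).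
  have gk : `|sigma * gb k| <= M by rewrite normrM sig mul1r.
  rewrite /E /T /H -/(gb k).
  move: (expR _) => z z0 zle.
  apply: (le_trans (ler_wpM2r (proj1 (andP H0)) zle)).
  have pk : (psi k - e) ^+ 2 <= K ^+ 2.
    by rewrite -[leLHS]real_normK ?num_real// lerXn2r ?nnegrE// (le_trans _ K2).
  have pg : (psi k - e) * (sigma * gb k) <= K * M.
    by rewrite (le_trans (ler_norm _))// normrM ler_pM.
  move: (psi k) (sigma * gb k) H0 pk pg => x w /andP[H0 H2] pk pg.
  have t2 : 0 <= theta ^+ 2 by rewrite sqr_ge0.
  rewrite (_ : (1 + theta * (x - e) + 2 * (theta * (x - e)) ^+ 2) * (1 + theta * w) =
    (1 - theta * e) + theta * (x + w) + theta ^+ 2 * ((x - e) * w) +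
    2 * theta ^+ 2 * ((x - e) ^+ 2 * (1 + theta * w))); last by ring.
  have h1 : (x - e) ^+ 2 * (1 + theta * w) <= K ^+ 2 * 2.
    by rewrite ler_pM// sqr_ge0.
  have h2 := ler_wpM2l t2 pg.
  have -> : 1 - theta * e + theta ^+ 2 * C0 + theta * (x + w) =
      (1 - theta * e) + theta * (x + w) + theta ^+ 2 * (K * M) +
      2 * theta ^+ 2 * (K ^+ 2 * 2) by rewrite /C0; ring.
  by apply: lerD; [rewrite lerD2l|rewrite ler_wpM2l// mulr_ge0].
pose B0 := `|1 - theta * e + theta ^+ 2 * C0| + theta * (1 + `|c| + M).
have TB : bounded_by B0 T.
  move=> k; rewrite (le_trans (ler_normD _ _))// lerD2l normrM gtr0_norm// ler_pM2l//.
  by rewrite (le_trans (ler_normD _ _))// lerD// normrM sig mul1r.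
have EB : bounded_by B0 E.
  by move=> k; rewrite ger0_norm// (le_trans (ET k))// (le_trans (ler_norm _)).
have Tmean : digit_mean s T <= (1 - theta * e / 4) * H s.
  have lin k1 k2 (v w : nat -> R) : (exists B, bounded_by B v) -> (exists B, bounded_by B w) ->
      digit_mean s (fun k => k1 + k2 * (v k + w k)) =
      k1 + k2 * (digit_mean s v + digit_mean s w).
    move=> [B1 B1v] [B2 B2w].
    pose B := B1 + B2 + (B1 + B2) + `|k1|.
    have B10 : 0 <= B1 by exact: le_trans (B1v 0%N).
    have B20 : 0 <= B2 by exact: le_trans (B2w 0%N).
    have k10 := normr_ge0 k1.
    have vB : bounded_by B v by move=> k; have := B1v k; rewrite /B; lra.
    have wB : bounded_by B w by move=> k; have := B2w k; rewrite /B; lra.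
    have vwB : bounded_by B (fun k => 1 * v k + w k).
      move=> k; rewrite mul1r (le_trans (ler_normD _ _))//.
      by have := B1v k; have := B2w k; rewrite /B; lra.
    have kB : bounded_by B (fun=> k1) by move=> k; rewrite /B; lra.
    have := digit_meanZD k2 sm1 vwB kB.
    rewrite digit_mean_cst// (digit_meanZD 1 sm1 vB wB) mul1r [RHS]addrC => <-.
    by congr digit_mean; apply/funext => k; rewrite mul1r addrC.
  have bI : exists B, bounded_by B (fun k => (b k)%:R : R).
    by exists 1; exact: bounded_by_ind.
  have bC x : exists B, bounded_by B (fun=> x : R) by exists `|x| => k.
  have bS : exists B, bounded_by B (fun k => sigma * gb k).
    by exists M => k; rewrite normrM sig mul1r.
  have psimean : digit_mean s psi = sigma * (f 0 s - c).
    rewrite -(digit_mean_cst (- c) sm1) -[RHS]add0r -lin//; congr digit_mean.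
    by apply/funext => k; rewrite add0r.
  have gmean : digit_mean s (fun k => sigma * gb k) = sigma * transfer (g N) s.
    rewrite -[transfer _ _]addr0 -(digit_mean_cst 0 sm1) -[RHS]add0r -lin//; last first.
      by exists M.
    by congr digit_mean; apply/funext => k; rewrite add0r addr0.
  rewrite lin//; last by exists (1 + `|c|).
  rewrite psimean gmean transfer_g// -mulrDr.
  (* The term [f 0 s - c] completes the shifted sum to [g N] and leaves over the term of index
     [N]. *)
  have -> : f 0 s - c + \sum_(j < N) (f j.+1 s - c) = g N s + (f N s - c).
    rewrite -[RHS](big_ord_recr N (fun j : 'I_N.+1 => f j s - c)).
    by rewrite big_ord_recl.
  have fN : sigma * (f N s - c) <= e / 4.
    rewrite (le_trans (ler_norm _))// normrM sig mul1r.
    exact: le_trans (f_cvg N s01) NE.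
  have tf := ler_wpM2l (ltW th0) fN.
  have tc := ler_wpM2l (ltW th0) thC.
  have := gM s sd; rewrite ler_norml /H => /andP[_ y4].
  have z4 : theta ^+ 2 * C0 <= theta * e / 4 by rewrite expr2 -!mulrA.
  have x4 : theta * (sigma * (f N s - c)) <= theta * e / 4 by rewrite -[leRHS]mulrA.
  have := drift_le (ltW the0) z4 x4 y4.
  by rewrite -[_ * (sigma * g N s) + _]mulrDr -[sigma * g N s + _]mulrDr.
rewrite (_ : digit_psum _ _ _ = 2 * digit_psum s E n); last first.
  by rewrite /digit_psum mulr_sumr; apply: eq_bigr => k _; rewrite /E /psi; ring.
rewrite mulrCA ler_pM2l// (le_trans (digit_psum_le_mean n sm1 EB E0))//.
exact: le_trans (digit_mean_le sm1 EB TB ET) Tmean.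
Qed.

End lyapunov.

(** * Almost everywhere convergence *)

Section deviations.
Context {R : realType}.
Local Notation mu := (@lebesgue_measure R).

(** Counted on [gauss x], whose digits from 0 on are those of [x] from 1 on; the integer part is
    thus left out. *)
Definition index_count (b : nat -> bool) (x : R) n : R :=
  \sum_(i < n) (b (gauss_index (gauss x) i))%:R.

Lemma geometric_nneseries_lt_pinfty (C rho : R) : 0 <= C -> 0 <= rho < 1 ->
  (\sum_(n <oo) (C * rho ^+ n)%:E < +oo)%E.
Proof.
move=> C0 /andP[r0 r1]; apply: (@le_lt_trans _ _ (C / (1 - rho))%:E); last exact: ltry.
apply: lime_le.
  by apply: is_cvg_nneseries => n _ _; rewrite lee_fin mulr_ge0// exprn_ge0.
apply: nearW => n; rewrite sumEFin lee_fin.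
have d0 : 0 < 1 - rho by rewrite subr_gt0.
have -> : \sum_(0 <= i < n) C * rho ^+ i = C / (1 - rho) * (1 - rho ^+ n).
  elim: n => [|n IH]; first by rewrite big_geq// expr0 subrr mulr0.
  by rewrite big_nat_recr//= IH exprSr; field; rewrite gt_eqF.
by rewrite ler_piMr ?divr_ge0 ?(ltW d0)// gerBl exprn_ge0.
Qed.

Variables (b : nat -> bool) (c D : R).
Hypothesis freq_cvg : forall n s, 0 <= s <= 1 ->
  `|iter n transfer (digit_freq b) s - c| <= D / 2 ^+ n.

(** For each integer part the deviation sets have measure at most [4 * rho ^+ n], a summable bound,
    so by Borel-Cantelli their upper limit is null. *)
Lemma deviation_negligible (sigma e : R) : `|sigma| = 1 -> 0 < e -> e <= 1 ->
  exists2 A : set R, mu.-negligible A & forall x, irrational x -> ~ A x ->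
    \forall n \near \oo, sigma * (index_count b x n - n%:R * c) <= n%:R * e.
Proof.
move=> sig e0 e1.
have [theta [rho [G [th0 rho01 G1 G04 GE]]]] := lyapunov freq_cvg sig e0 e1.
have /andP[rho0 rho1] := rho01.
(* The tolerance [e] is subtracted inside [phi], so the threshold is 0; the initial state
   [(m, 1, 0)] encodes [x = m + z^-1]. *)
pose phi k := theta * (sigma * ((b k)%:R - c) - e).
pose F (m : int) n := deviation_set phi n (m%:~R : R) 1 0 0.
have muF m n : (mu (F m n) <= (4 * rho ^+ n)%:E)%E.
  have s01 : 0 <= (0 : R) <= 1 by rewrite lexx ler01.
  apply: (le_trans (deviation_set_measure rho0 G1 GE n m%:~R 1 0 s01)).
  rewrite lee_fin oppr0 expR0 mul1r mulr0 subr0 addr0 normr1 divr1 mulr1 mulrC.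
  by rewrite ler_wpM2r// exprn_ge0.
(* One set per integer part, enumerated by [unpickle]; the default 0 for other codes only repeats a
   set. *)
exists (\bigcup_k lim_sup_set (F (odflt 0 (unpickle k)))).
  apply: negligible_bigcup => k; set m := odflt _ _.
  have mF n : measurable (F m n) by exact: measurable_deviation_set.
  apply/negligibleP.
    by apply: bigcap_measurable => // n _; apply: bigcup_measurable => j _; exact: mF.
  apply: lim_sup_set_cvg0 => //.
  apply: le_lt_trans (geometric_nneseries_lt_pinfty (ler0n R 4) rho01).
  by apply: lee_nneseries => [n _ _|n _]; [exact: measure_ge0|exact: muF].
move=> x ix nA.
have [N NF] : exists N, forall n, (N <= n)%N -> ~ F (Num.floor x) n x.
  apply: contrapT => /forallNP nF; apply: nA.
  exists (pickle (Num.floor x)) => //; rewrite pickleK /= => N _.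
  have /existsNP[n /not_implyP[Nn /contrapT Fx]] := nF N.
  by exists n.
exists N => // n /= /NF nFx; rewrite leNgt; apply/negP => dev; apply: nFx.
have z1 := gauss_gt1 ix.
have xE : ((Num.floor x)%:~R * gauss x + 1) / (gauss x + 0) = x.
  by rewrite addr0 mulrDl mulfK ?mul1r -?gaussE// gt_eqF// (lt_trans ltr01).
have := @mem_deviation_set R phi n (Num.floor x)%:~R 1 0 0 _
  (gauss_irrational ix) z1 (lexx 0).
rewrite xE; apply.
rewrite -mulr_sumr pmulr_rge0// sumrB sumr_const card_ord -mulr_natl subr_ge0.
rewrite -mulr_sumr sumrB sumr_const card_ord -[c *+ n]mulr_natl.
exact: ltW.
Qed.

(** The tolerances [1 / (j + 1)] and the two signs give countably many null sets, whose union is the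
    exceptional set. *)
Lemma index_count_cvg : exists2 A : set R, mu.-negligible A &
  forall x, irrational x -> ~ A x -> index_count b x n / n%:R @[n --> \oo] --> c.
Proof.
have e0 j : 0 < (j.+1%:R^-1 : R) by rewrite invr_gt0 ltr0n.
have e1 j : (j.+1%:R^-1 : R) <= 1 by rewrite invf_le1 ?ltr0n// ler1n.
have devp j : exists A : set R, mu.-negligible A /\ forall x, irrational x -> ~ A x ->
    \forall n \near \oo, 1 * (index_count b x n - n%:R * c) <= n%:R * j.+1%:R^-1.
  by have [A A1 A2] := deviation_negligible (normr1 R) (e0 j) (e1 j); exists A.
have devn j : exists A : set R, mu.-negligible A /\ forall x, irrational x -> ~ A x ->
    \forall n \near \oo, -1 * (index_count b x n - n%:R * c) <= n%:R * j.+1%:R^-1.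
  by have [A A1 A2] := deviation_negligible (normrN1 R) (e0 j) (e1 j); exists A.
have /choice[P PE] := devp; have /choice[Q QE] := devn.
exists (\bigcup_j P j `|` \bigcup_j Q j).
  by apply: negligibleU; apply: negligible_bigcup => j; [case: (PE j)|case: (QE j)].
move=> x ix /not_orP[nP nQ]; apply/cvgrPdist_le => e ep.
have [j je] : exists j, j.+1%:R^-1 <= e.
  have /cvgrPdist_le/(_ e ep)[j _ /(_ j (leqnn j))/=] := @cvg_harmonic R.
  by rewrite sub0r normrN gtr0_norm// => je; exists j.
have xP : ~ P j x by move=> xP; apply: nP; exists j.
have xQ : ~ Q j x by move=> xQ; apply: nQ; exists j.
have hP := (PE j).2 x ix xP; have hQ := (QE j).2 x ix xQ.
near=> n.
have n0 : 0 < n%:R :> R by rewrite ltr0n; near: n; exists 1%N.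
have h1 : 1 * (index_count b x n - n%:R * c) <= n%:R * j.+1%:R^-1 by near: n.
have h2 : -1 * (index_count b x n - n%:R * c) <= n%:R * j.+1%:R^-1 by near: n.
rewrite (le_trans _ je)//.
have -> : c - index_count b x n / n%:R = - ((index_count b x n - n%:R * c) / n%:R).
  by field; rewrite gt_eqF.
rewrite normrN normrM [`|_^-1|]gtr0_norm ?invr_gt0// ler_pdivrMr// [leRHS]mulrC.
by rewrite ler_norml; apply/andP; split; [rewrite lerNl -mulN1r|rewrite -[leLHS]mul1r].
Unshelve. all: by end_near. Qed.

End deviations.

(** * Digits of the form [n ^ 2 - 1] and the limit frequency *)

Lemma mem_square_minus_one (d : int) : 0 < d ->
  (d \in square_minus_one) = square_index `|d|.-1.
Proof.
move=> d0; apply/idP/idP.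
  rewrite inE => -[n /= n1 nd]; apply/asboolP.
  by exists n.-2; move: d0 n1; rewrite -nd !expnS expn0 expr2; nia.
move=> /asboolP[n nE]; rewrite inE; exists n.+2 => //=.
by move: nE d0; rewrite !expnS expn0 expr2; nia.
Qed.

Lemma cf_digit_countE {R : realType} (x : R) n : irrational x ->
  (cf_digit_count square_minus_one x n)%:R = index_count square_index x n.
Proof.
move=> ix; rewrite /cf_digit_count /index_count; elim: n => [|n IH].
  by rewrite big_ord0.
rewrite -[n.+1]addn1 iotaD count_cat natrD IH addn1 big_ord_recr/= addn0 add1n.
congr (_ + _); rewrite cf_digitsE// iterSr.
rewrite -[Num.floor _]/(gauss_digits (gauss x) n) mem_square_minus_one//.
exact: gauss_digits_gt0 (gauss_irrational ix) (gauss_gt1 ix).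
Qed.

Theorem theorem1p2 (R : realType) :
  {ae (@lebesgue_measure R), forall x : R,
    ((cf_digit_count square_minus_one x n)%:R / n%:R : R) @[n --> \oo] -->
      log2 (8 * pi / (expR pi - expR (- pi)) : R)}.
Proof.
have [A A0 AE] := index_count_cvg
  (fun n s => @digit_freq_cvg R square_index _ n s square_index_ge2 sum_square_weight_cvg).
(* The rationals, where the digits take dummy values, are countable and hence null. *)
have rat0 : (@lebesgue_measure R).-negligible rational.
  have crat : countable (@rational R).
    by apply: card_le_trans (card_image_le _ _) _; exact: countableP.
  apply/negligibleP; last exact: countable_lebesgue_measure0.
  exact: countable_measurable.
apply: negligibleS (negligibleU rat0 A0) => x /= nx.
have [xr|ix] := pselect (rational x); [by left|right].
apply: contrapT => nA; apply: nx; rewrite /log2.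
under eq_fun do rewrite cf_digit_countE//.
exact: AE.
Qed.
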